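(* Let $q\ge 1$ and $N\ge 0$ be integers, let $\tau_q\ge\dots\ge\tau_1>0$, and consider the time-delay system $$\dot x(t)=f(x(t),x(t-\tau_1),\dots,x(t-\tau_q))+g(x(t))u(t),\quad y(t)=h(x(t)),\quad t\ge 0,\qquad x(t)=\phi(t),\ t\in[-\tau_q,0],$$ with state $x(t)\in\mathbb{R}^n$, input $u(t)\in\mathbb{R}^m$, output $y(t)\in\mathbb{R}^m$, where $f:\mathbb{R}^{n(q+1)}\to\mathbb{R}^n$ and $g:\mathbb{R}^n\to\mathbb{R}^{n\times m}$ are locally Lipschitz continuous and $h:\mathbb{R}^n\to\mathbb{R}^m$. Consider the quadratic supply rate $$s(y,u)=\begin{bmatrix}y\\ u\end{bmatrix}^\top\begin{bmatrix}S_{11}&S_{12}\\S_{12}^\top&S_{22}\end{bmatrix}\begin{bmatrix}y\\ u\end{bmatrix},\qquad S_{11}=S_{11}^\top,\ S_{22}=S_{22}^\top,\ S_{11},S_{12},S_{22}\in\mathbb{R}^{m\times m}.$$ Suppose there exists a function $\mathcal{S}_N$ of the form $$\mathcal{S}_N(x_t)=\mathcal{S}_1(x(t))+\hat x_N(t)^\top P_N\hat x_N(t)+\sum_{i=1}^q\int_{t-\tau_i}^t\Theta_i(x(s))\,ds+\sum_{i=1}^q\tau_i\int_{t-\tau_i}^t\int_\theta^t\dot x(s)^\top R_i\dot x(s)\,ds\,d\theta,$$ with $\mathcal{S}_N(0)=0$, where $\mathcal{S}_1:\mathbb{R}^n\to[0,\infty)$ is continuously differentiable, $P_N\in\mathbb{R}^{qnN\times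 qnN}$ is symmetric positive semidefinite, $\Theta_i:\mathbb{R}^n\to[0,\infty)$ are continuous positive semidefinite functions, $R_i\in\mathbb{R}^{n\times n}$ are symmetric positive semidefinite ($i=1,\dots,q$), and $\hat x_N$ is defined in the context, such that for all $x_0,x_1,\dots,x_q\in\mathbb{R}^n$ and all $\xi_N^i=[x_0^\top\ x_i^\top\ (\omega_0^i)^\top\cdots(\omega_{N-1}^i)^\top]^\top\in\mathbb{R}^{n(N+2)}$, $i=1,\dots,q$ (with arbitrary $\omega^i_k\in\mathbb{R}^n$, $0\le k\le N-1$), the symmetric matrix $$\begin{bmatrix}\Psi_{xx}(x_0,\dots,x_q,\xi_N^1,\dots,\xi_N^q)&\Psi_{xu}(x_0,\dots,x_q)\\ \Psi_{xu}(x_0,\dots,x_q)^\top&\Psi_{uu}(x_0)\end{bmatrix}$$ is negative semidefinite. Here, with $$\zeta=\big[x_0^\top\ x_1^\top\ \cdots\ x_q^\top\ (\omega^1_0)^\top\cdots(\omega^1_{N-1})^\top\ \cdots\ (\omega^q_0)^\top\cdots(\omega^q_{N-1})^\top\big]^\top\in\mathbb{R}^{n(1+q+qN)}$$ and $f=f(x_0,\dots,x_q)$, $$\Psi_{xx}=\nabla\mathcal{S}_1(x_0)^\top f+2\zeta^\top\mathrm{sym}(G_N^\top P_NH_N)\zeta+\sum_{i=1}^q\tau_i^2f^\top R_if+\sum_{i=1}^q\Theta_i(x_0)-\sum_{i=1}^q\Theta_i(x_i)-\zeta^\top\mathbf{\Gamma}_N^\top\mathbf{R}_N\mathbf{\Gamma}_N\zeta-h(x_0)^\top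 S_{11}h(x_0),$$ $$\Psi_{xu}=\tfrac12\nabla\mathcal{S}_1(x_0)^\top g(x_0)+\sum_{i=1}^q\tau_i^2f^\top R_ig(x_0)-h(x_0)^\top S_{12},\qquad \Psi_{uu}=\sum_{i=1}^q\tau_i^2g(x_0)^\top R_ig(x_0)-S_{22},$$ with the matrices $G_N,H_N,\mathbf{\Gamma}_N,\mathbf{R}_N$ defined in the context. Then the system is dissipative with respect to the supply rate $s$.
   Context: Notation: $\mathrm{sym}(A)=\frac12(A+A^\top)$; $\mathrm{diag}$ denotes block-diagonal matrices; $I$ is the $n\times n$ identity and $I_k$ the $k\times k$ identity; $x_t(\theta)=x(t+\theta)$ for $\theta\in[-\tau_q,0]$. Dissipativity: the system with delays $\tau_q\ge\dots\ge\tau_1>0$ is dissipative with respect to a continuous supply rate $s:\mathbb{R}^m\times\mathbb{R}^m\to\mathbb{R}$ if there is a storage function $\mathcal{S}:C^1([-\tau_q,0],\mathbb{R}^n)\to[0,\infty)$ with $\mathcal{S}(0)=0$ such that $$\mathcal{S}(x_{t_1})-\mathcal{S}(x_{t_0})\le\int_{t_0}^{t_1}s(y(r),u(r))\,dr\qquad\text{for all }0\le t_0\le t_1<\infty$$ and all initial histories $\phi\in C^1([-\tau_q,0],\mathbb{R}^n)$ (and all admissible inputs $u$), where $x$ is the solution of the system with history $\phi$ and $y$ is the corresponding output. Extra states. For $k\in\mathbb{N}$ (including $0$) and $i=1,\dots,q$ let $L^i_k(s)=(-1)^k\sum_{l=0}^k(-1)^l\binom{k}{l}\binom{k+l}{l}\left(\frac{s+\tau_i}{\tau_i}\right)^l$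 be the Legendre polynomials on $[-\tau_i,0]$ and $\Omega^i_k(t)=\int_{-\tau_i}^0L^i_k(s)x_t(s)\,ds$. For $N\ge1$, $\hat x_N(t)=[\Omega^1_0(t)^\top\cdots\Omega^1_{N-1}(t)^\top\ \cdots\ \Omega^q_0(t)^\top\cdots\Omega^q_{N-1}(t)^\top]^\top$; for $N=0$, $\hat x_0(t)=0$. Along solutions the variables above stand for $x_0=x(t)$, $x_i=x(t-\tau_i)$, $\omega^i_k=\frac1{\tau_i}\Omega^i_k(t)$. Matrices. For $0\le k\le N$ and $0\le j\le N-1$ set $\gamma^j_{Nk}=-(2j+1)(1-(-1)^{k+j})$ if $j\le k$ and $\gamma^j_{Nk}=0$ if $j>k$. For $1\le i\le q$ and $0\le k\le N$, let $\tilde\Gamma_{N,i}(k)\in\mathbb{R}^{n\times n(1+q+qN)}$ be the block row, partitioned as $\zeta$ is, determined by $$\tilde\Gamma_{N,i}(k)\zeta=x_0+(-1)^{k+1}x_i+\sum_{j=0}^{N-1}\gamma^j_{Nk}\,\omega^i_j$$ (for $N=0$: $\tilde\Gamma_{0,i}(0)\zeta=x_0-x_i$). Let $\Gamma_{N,i}$ be the vertical stack of $\tilde\Gamma_{N,i}(0),\dots,\tilde\Gamma_{N,i}(N)$ and $\mathbf{\Gamma}_N$ the vertical stack of $\Gamma_{N,1},\dots,\Gamma_{N,q}$. Let $R_{N,i}=\mathrm{diag}(R_i,3R_i,\dots,(2N+1)R_i)$ and $\mathbf{R}_N=\mathrm{diag}(R_{N,1},\dots,R_{N,q})$. Let $H_N\in\mathbb{R}^{qnN\times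 n(1+q+qN)}$ be the vertical stack of $\tilde\Gamma_{N,1}(0),\dots,\tilde\Gamma_{N,1}(N-1),\tilde\Gamma_{N,2}(0),\dots,\tilde\Gamma_{N,q}(N-1)$, and let $$G_N=\begin{bmatrix}0_{qnN\times n(1+q)}&\mathrm{diag}(\tau_1I_{nN},\dots,\tau_qI_{nN})\end{bmatrix}\in\mathbb{R}^{qnN\times n(1+q+qN)}.$$ For $N=0$ there are no $\omega^i_k$ and the terms involving $P_N$ are absent. *)

(* Defs.v *)
From HB Require Import structures.
From mathcomp Require Import all_boot all_order all_algebra.
From mathcomp Require Import all_classical all_reals all_analysis.

Set Implicit Arguments.
Unset Strict Implicit.
Unset Printing Implicit Defensive.

Import Order.TTheory GRing.Theory Num.Theory.
Import numFieldNormedType.Exports.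

Local Open Scope classical_set_scope.
Local Open Scope ring_scope.

Section LinearAlgebra.
Variable R : realType.

Definition qform n (M : 'M[R]_n) (v : 'cV[R]_n) : R := (v^T *m M *m v) 0 0.

Definition psd n (M : 'M[R]_n) : Prop :=
  M^T = M /\ forall v : 'cV[R]_n, 0 <= qform M v.

Definition nsd n (M : 'M[R]_n) : Prop :=
  M^T = M /\ forall v : 'cV[R]_n, qform M v <= 0.

Definition sym n (M : 'M[R]_n) : 'M[R]_n := 2^-1 *: (M + M^T).

End LinearAlgebra.

Section Regularity.
Variable R : realType.

Definition gradient n (V : 'cV[R]_n -> R) (x : 'cV[R]_n) : 'cV[R]_n :=
  \col_a 'D_(delta_mx a 0) V x.

Definition C1_fun n (V : 'cV[R]_n -> R) : Prop :=
  (forall x, differentiable V x) /\ continuous (gradient V).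

Definition psd_fun n (V : 'cV[R]_n -> R) : Prop :=
  V 0 = 0 /\ forall x, 0 <= V x.

Definition locally_lipschitz (V W : normedModType R) (F : V -> W) : Prop :=
  [locally [lipschitz F x | x in setT]].

(* The difference quotients are taken within [a, b], so the derivative is
   one-sided at the endpoints and [phi] is unconstrained outside [a, b]. *)
Definition C1_on n (a b : R) (phi : R -> 'cV[R]_n) : Prop :=
  exists dphi : R -> 'cV[R]_n,
    {within `[a, b], continuous dphi} /\
    forall s, s \in `[a, b] ->
      (t - s)^-1 *: (phi t - phi s) @[t --> within `[a, b] s^'] --> dphi s.

Definition abs_continuous_on n (a b : R) (x : R -> 'cV[R]_n) : Prop :=
  forall e : R, 0 < e -> exists2 d : R, 0 < d &
    forall (p : nat) (l r : 'I_p -> R),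
      (forall i, [/\ a <= l i, l i <= r i & r i <= b]) ->
      (forall i j, i != j -> r i <= l j \/ r j <= l i) ->
      \sum_(i < p) (r i - l i) < d ->
      \sum_(i < p) `|x (r i) - x (l i)| < e.

End Regularity.

Section DelaySystem.
Variables (R : realType) (n m q : nat).

(* There are q.+1 >= 1 delays, in nondecreasing order: [tau ord0] is the
   smallest one and [tau ord_max] the largest.  The argument of [f] is the
   column vector stacking x(t), x(t - tau_1), x(t - tau_2), etc. *)
Variable tau : 'I_q.+1 -> R.

Variable f : 'cV[R]_(n + \sum_(i < q.+1) n) -> 'cV[R]_n.
Variable g : 'cV[R]_n -> 'M[R]_(n, m).
Variable h : 'cV[R]_n -> 'cV[R]_m.

Definition segment (x : R -> 'cV[R]_n) (t : R) : R -> 'cV[R]_n :=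
  fun theta => x (t + theta).

Definition dynamics (x : R -> 'cV[R]_n) (u : R -> 'cV[R]_m) (t : R) :
    'cV[R]_n :=
  f (col_mx (x t) (\mxcol_(i < q.+1) x (t - tau i))) + g (x t) *m u t.

(* Locally bounded measurable inputs: this includes the (piecewise) continuous
   ones, and the supply is integrable for every continuous supply rate and
   output map. *)
Definition admissible_input (T : R) (u : R -> 'cV[R]_m) : Prop :=
  (forall a, measurable_fun `[0, T] (fun t => u t a 0)) /\
  exists M : R, forall t, t \in `[0, T] -> `|u t| <= M.

(* Solutions in the sense of Caratheodory; for a continuous input these are the
   classical solutions. *)
Definition solution (T : R) (phi : R -> 'cV[R]_n) (u : R -> 'cV[R]_m)
    (x : R -> 'cV[R]_n) : Prop :=
  [/\ forall t, t \in `[- tau ord_max, 0] -> x t = phi t,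
      abs_continuous_on 0 T x &
      {ae (@lebesgue_measure R), forall t, t \in `]0, T[ ->
         is_derive t (1 : R) x (dynamics x u t)}].

(* The segment x_t of a solution need not be C^1 for 0 <= t < tau ord_max (the
   derivative may jump at time 0), so [S] is a nonnegative functional on all
   functions; the third clause says that it is a functional of the restriction
   to [- tau ord_max, 0].
   The inequality is required on every interval [0, T] on which the solution
   exists; a global solution is a solution on [0, T] for every T.
   The right-hand side is an extended real, so no integrability of the supply
   is presupposed. *)
Definition dissipative (s : 'cV[R]_m -> 'cV[R]_m -> R) : Prop :=
  exists S : (R -> 'cV[R]_n) -> R,
    [/\ S (fun=> 0) = 0,
        forall phi, 0 <= S phi,
        forall phi psi,
          {in `[- tau ord_max, 0], phi =1 psi} -> S phi = S psi &
        forall (T : R) (phi : R -> 'cV[R]_n) (u : R -> 'cV[R]_m)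
            (x : R -> 'cV[R]_n),
          C1_on (- tau ord_max) 0 phi ->
          admissible_input T u ->
          solution T phi u x ->
          forall t0 t1 : R, 0 <= t0 -> t0 <= t1 -> t1 <= T ->
            ((S (segment x t1) - S (segment x t0))%:E <=
             \int[@lebesgue_measure R]_(r in `[t0, t1])
               (s (h (x r)) (u r))%:E)%E].

End DelaySystem.

Section Supply.
Variables (R : realType) (m : nat).

Definition quadratic_supply (S11 S12 S22 : 'M[R]_m) (y u : 'cV[R]_m) : R :=
  qform (block_mx S11 S12 S12^T S22) (col_mx y u).

End Supply.

Section Matrices.
Variables (R : realType) (n q N : nat).
Implicit Types (tau : 'I_q -> R) (Rm : 'I_q -> 'M[R]_n).

Local Notation dX := (n + \sum_(i < q) n)%N.
Local Notation dW := (\sum_(i < q) \sum_(k < N) n)%N.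

Definition zeta (x0 : 'cV[R]_n) (xd : 'I_q -> 'cV[R]_n)
    (w : 'I_q -> 'I_N -> 'cV[R]_n) : 'cV[R]_(dX + dW) :=
  col_mx (col_mx x0 (\mxcol_(i < q) xd i))
         (\mxcol_(i < q) \mxcol_(k < N) w i k).

Definition gammac (k j : nat) : R :=
  if (j <= k)%N then - ((2 * j + 1)%:R * (1 - (-1) ^+ (k + j))) else 0.

Definition Gamma_row (i : 'I_q) (k : nat) : 'M[R]_(n, dX + dW) :=
  row_mx
    (row_mx 1%:M
       (\mxrow_(j < q) (if j == i then ((-1) ^+ k.+1)%:M else 0 : 'M[R]_n)))
    (\mxrow_(j < q) \mxrow_(l < N)
       (if j == i then (gammac k l)%:M else 0 : 'M[R]_n)).

Definition Gamma_blk (i : 'I_q) : 'M[R]_(\sum_(k < N.+1) n, dX + dW) :=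
  \mxcol_(k < N.+1) Gamma_row i k.

Definition Gamma_mx : 'M[R]_(\sum_(i < q) \sum_(k < N.+1) n, dX + dW) :=
  \mxcol_(i < q) Gamma_blk i.

Definition R_blk Rm (i : 'I_q) : 'M[R]_(\sum_(k < N.+1) n) :=
  \mxdiag_(k < N.+1) ((2 * k + 1)%:R *: Rm i).

Definition R_mx Rm : 'M[R]_(\sum_(i < q) \sum_(k < N.+1) n) :=
  \mxdiag_(i < q) R_blk Rm i.

Definition H_mx : 'M[R]_(dW, dX + dW) :=
  \mxcol_(i < q) \mxcol_(k < N) Gamma_row i k.

Definition G_mx tau : 'M[R]_(dW, dX + dW) :=
  row_mx 0 (\mxdiag_(i < q) ((tau i)%:M : 'M[R]_(\sum_(k < N) n))).

End Matrices.

Section StorageForm.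
Variables (R : realType) (n q N : nat).
Variable tau : 'I_q -> R.

Local Notation mu := (@lebesgue_measure R).

Definition legendre (i : 'I_q) (k : nat) (s : R) : R :=
  (-1) ^+ k * \sum_(l < k.+1)
    (-1) ^+ l * 'C(k, l)%:R * 'C(k + l, l)%:R * ((s + tau i) / tau i) ^+ l.

Definition Omega (i : 'I_q) (k : nat) (phi : R -> 'cV[R]_n) : 'cV[R]_n :=
  \col_a \int[mu]_(s in `[- tau i, 0]) (legendre i k s * phi s a 0).

Definition xhat (phi : R -> 'cV[R]_n) :
    'cV[R]_(\sum_(i < q) \sum_(k < N) n) :=
  \mxcol_(i < q) \mxcol_(k < N) Omega i k phi.

(* This is the functional of the segment phi = x_t: the integrals over
   [t - tau_i, t] have been shifted to [- tau_i, 0]. [derive1] is the two-sided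
   derivative, so that of an absolutely continuous phi is the right one almost
   everywhere, which is all that matters under the integral. *)
Definition storage_form (S1 : 'cV[R]_n -> R)
    (P : 'M[R]_(\sum_(i < q) \sum_(k < N) n))
    (Theta : 'I_q -> 'cV[R]_n -> R) (Rm : 'I_q -> 'M[R]_n)
    (phi : R -> 'cV[R]_n) : R :=
  S1 (phi 0) + qform P (xhat phi)
  + \sum_(i < q) \int[mu]_(s in `[- tau i, 0]) Theta i (phi s)
  + \sum_(i < q) tau i *
      \int[mu]_(theta in `[- tau i, 0])
        \int[mu]_(s in `[theta, 0]) qform (Rm i) (derive1 phi s).

End StorageForm.

Section DissipationMatrix.
Variables (R : realType) (n m q N : nat).
Variables (tau : 'I_q -> R).
Variable f : 'cV[R]_(n + \sum_(i < q) n) -> 'cV[R]_n.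
Variable g : 'cV[R]_n -> 'M[R]_(n, m).
Variable h : 'cV[R]_n -> 'cV[R]_m.
Variables S11 S12 S22 : 'M[R]_m.
Variable S1 : 'cV[R]_n -> R.
Variable P : 'M[R]_(\sum_(i < q) \sum_(k < N) n).
Variable Theta : 'I_q -> 'cV[R]_n -> R.
Variable Rm : 'I_q -> 'M[R]_n.

Definition Psi_xx (x0 : 'cV[R]_n) (xd : 'I_q -> 'cV[R]_n)
    (w : 'I_q -> 'I_N -> 'cV[R]_n) : 'M[R]_1 :=
  let F := f (col_mx x0 (\mxcol_(i < q) xd i)) in
  let z := zeta x0 xd w in
  (gradient S1 x0)^T *m F
  + 2 *: (z^T *m sym ((G_mx n N tau)^T *m P *m H_mx R n q N) *m z)
  + \sum_(i < q) tau i ^+ 2 *: (F^T *m Rm i *m F)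
  + (\sum_(i < q) Theta i x0)%:M - (\sum_(i < q) Theta i (xd i))%:M
  - z^T *m (Gamma_mx R n q N)^T *m R_mx N Rm *m Gamma_mx R n q N *m z
  - (h x0)^T *m S11 *m h x0.

Definition Psi_xu (x0 : 'cV[R]_n) (xd : 'I_q -> 'cV[R]_n) : 'rV[R]_m :=
  let F := f (col_mx x0 (\mxcol_(i < q) xd i)) in
  2^-1 *: ((gradient S1 x0)^T *m g x0)
  + \sum_(i < q) tau i ^+ 2 *: (F^T *m Rm i *m g x0)
  - (h x0)^T *m S12.

Definition Psi_uu (x0 : 'cV[R]_n) : 'M[R]_m :=
  \sum_(i < q) tau i ^+ 2 *: ((g x0)^T *m Rm i *m g x0) - S22.

Definition Psi_mx (x0 : 'cV[R]_n) (xd : 'I_q -> 'cV[R]_n)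
    (w : 'I_q -> 'I_N -> 'cV[R]_n) : 'M[R]_(1 + m) :=
  block_mx (Psi_xx x0 xd w) (Psi_xu x0 xd) (Psi_xu x0 xd)^T (Psi_uu x0).

End DissipationMatrix.

(* Main.v *)
(* Along a solution, the storage functional is absolutely continuous in time, and
   the Legendre moments satisfy, by parts, d/dt Omega_k = Gamma~(k) zeta, which is
   also the k-th Legendre moment of the velocity.  The term R_i contributes
   tau_i^2 v^T R_i v - tau_i int v^T R_i v, and Bessel's inequality for the
   Legendre polynomials bounds the last integral below by the Gamma^T R Gamma
   term.  Hence the derivative of the storage is at most Psi evaluated at (1, u)
   plus the supply, i.e. at most the supply, almost everywhere.
   The solution is only absolutely continuous, the input only measurable, and the
   output map h is arbitrary, so the supply need not be measurable; comparing
   integrals then relies on their being defined by suprema over simple functions. *)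
Require Import Defs.
From HB Require Import structures.
From mathcomp Require Import all_boot all_order all_algebra.
From mathcomp Require Import all_classical all_reals all_analysis.
From mathcomp Require Import measurable_realfun ring lra.

Set Implicit Arguments.
Unset Strict Implicit.
Unset Printing Implicit Defensive.

Import Order.TTheory GRing.Theory Num.Theory.
Import numFieldNormedType.Exports.

Local Open Scope classical_set_scope.
Local Open Scope ring_scope.

(** * Absolutely continuous functions *)

(** What shapes the proof is that the velocity is known only almost everywhere. Along a trajectory
    on [0, T] the vector fields are bounded by continuity and the input is bounded, so the velocity
    is bounded and the solution is Lipschitz. Integration by parts and the fundamental theorem of
    calculus are therefore needed for Lipschitz functions only. Both rest on one fact: an absolutely
    continuous function whose derivative has norm at most M almost everywhere changes by at most M
    (b - a) over [a, b]. It is proved by Cousin's lemma, without a covering theorem. The moments,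
    the averages of [Theta i] and the averaged part of the kinetic term are convolutions of a
    continuous function with a polynomial, hence differentiable at every time. Almost everywhere
    arguments remain only for the state and for the primitives of v^T R_i v. Histories, inputs and
    solutions are unconstrained outside their intervals. Freezing them there gives functions that
    are continuous, or locally bounded and measurable, on the whole line, and spares the calculus
    all endpoint conditions. *)

(** The local hypothesis at the supremum of the t with [P a t] both reaches this supremum and goes
    past it, unless it is b. Only intervals containing c are concerned, so the width may depend on c
    with no uniformity. *)
Lemma cousin (R : realType) (P : R -> R -> Prop) (a b : R) : a <= b ->
  (forall r s t, a <= r -> r <= s -> s <= t -> t <= b ->
    P r s -> P s t -> P r t) ->
  (forall c, a <= c -> c <= b -> exists2 e, 0 < e &
    forall s t, a <= s -> s <= c -> c <= t -> t <= b ->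
      c - e < s -> t < c + e -> P s t) ->
  P a b.
Proof.
move=> ab Ptr Ploc.
pose A := [set t | a <= t <= b /\ P a t].
have Aa : A a.
  split; first by rewrite lexx.
  have [e e0] := Ploc a (lexx a) ab.
  by apply=> //; rewrite ?ltrBlDr ?ltrDl.
have Aub : ubound A b by move=> t [/andP[]].
have supA : has_sup A by split; [exists a|exists b].
have ac : a <= sup A by apply: (ub_le_sup supA.2).
have cb : sup A <= b by apply: ge_sup => //; exists a.
have [e e0 Pe] := Ploc _ ac cb.
have [t [/andP[at_ tb] Pat] tc] := sup_adherent e0 supA.
have tc' : t <= sup A by apply: (ub_le_sup supA.2); split; rewrite ?at_.
pose d := Order.min b (sup A + e / 2).
have cd : sup A <= d by rewrite /d le_min cb/= lerDl; lra.
have db : d <= b by rewrite /d ge_min lexx.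
have de : d < sup A + e by rewrite /d gt_min; apply/orP; right; lra.
have Pad : P a d.
  apply: (Ptr a t d) => //; first exact: (le_trans tc').
  exact: Pe.
have : d <= sup A.
  apply: (ub_le_sup supA.2); split => //.
  by rewrite db (le_trans ac cd).
rewrite {1}/d ge_min => /orP[bc|]; last by lra.
suff <- : d = b by [].
by apply/le_anti; rewrite db (le_trans bc cd).
Qed.

Section AbsolutelyContinuous.
Variables (R : realType) (V : normedModType R).
Local Notation mu := (@lebesgue_measure R).
Implicit Types (y : R -> V).

Let chain (L : seq (R * R)) := pairwise (fun p q : R * R => p.2 <= q.1) L.

Lemma is_derive1_near y (t : R) (d : V) (e : R) : is_derive t 1 y d -> 0 < e ->
  \forall s \near t, `|y s - y t| <= (`|d| + e) * `|s - t|.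
Proof.
move=> [dy dE] e0.
have : h^-1 *: (y (h + t) - y t) @[h --> 0^'] --> d.
  rewrite -dE; have /derivable_nbhs := dy.
  move: dy; rewrite /derivable /derive => dy _.
  have -> : (fun h => h^-1 *: (y (h + t) - y t)) =
            (fun h => h^-1 *: ((y \o shift t) (h *: 1) - y t)).
    by apply/funext => h /=; rewrite /shift /= [h *: 1]mulr1.
  exact: dy.
move=> /cvgrPdist_lt /(_ _ e0); rewrite near_withinE => /= H.
have : \forall h \near (0 : R), `|y (h + t) - y t| <= (`|d| + e) * `|h|.
  apply: filterS H => h Hh.
  have [->|h0] := eqVneq h 0; first by rewrite add0r subrr !normr0 mulr0.
  have {}Hh := Hh h0.
  rewrite -ler_pdivrMr ?normr_gt0// mulrC -normfV -normrZ.
  rewrite -[X in `|X|](subKr d) (le_trans (ler_normB _ _))// lerD2l.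
  exact: ltW.
move=> H1; rewrite (nbhs0P (fun s => `|y s - y t| <= (`|d| + e) * `|s - t|)).
by apply: filterS H1 => h; rewrite [t + h]addrC addrK.
Qed.

(* On the null set where the derivative is not controlled, Cousin's lemma uses
   intervals inside an open set of small measure, over which the variation of
   [y] is small; elsewhere it uses the derivative. *)
Lemma absolutely_continuous_le y (a b M : R) : a <= b -> 0 <= M ->
  (forall e : R, 0 < e -> exists2 d : R, 0 < d &
    forall (p : nat) (l r : 'I_p -> R),
      (forall i, [/\ a <= l i, l i <= r i & r i <= b]) ->
      (forall i j, i != j -> r i <= l j \/ r j <= l i) ->
      \sum_(i < p) (r i - l i) < d ->
      \sum_(i < p) `|y (r i) - y (l i)| < e) ->
  {ae mu, forall t, t \in `]a, b[ ->
     exists2 d, is_derive t 1 y d & `|d| <= M} ->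
  `|y b - y a| <= M * (b - a).
Proof.
move=> ab M0 yAC [N [mN N0 subN]].
suff H e : 0 < e -> `|y b - y a| <= (M + e) * (b - a) + e.
  apply/ler_addgt0Pr => e e0.
  (* The excess in the bound is e' (b - a) + e', which is e for this choice of e'. *)
  have e'0 : 0 < e / (b - a + 1) by apply: divr_gt0 => //; lra.
  apply: le_trans (H _ e'0) _.
  rewrite mulrDl -addrA lerD2l -[X in _ + X <= _]mulr1 -mulrDr.
  by rewrite divfK//; lra.
move=> e0.
have [d d0 yd] := yAC e e0.
(* The derivative is known in the open interval only, so the endpoints join the exceptional set. *)
pose N' := N `|` [set a] `|` [set b].
have mN' : measurable N' by do 2 apply: measurableU => //.
have N'0 : mu N' = 0%E.
  rewrite /N' !measureU0//.
  - exact: lebesgue_measure_set1.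
  - exact: measurableU.
  - exact: lebesgue_measure_set1.
have [|U [oU NU mU]] := @lebesgue_regularity_outer R N' d mN' _ d0.
  by rewrite [X in (X < _)%E]N'0 ltry.
have mUd : (mu U < d%:E)%E.
  apply: le_lt_trans mU.
  have mU' : measurable U by exact: measurable_realfun.open_measurable.
  rewrite -[X in (mu X <= _)%E](setDUK NU) (le_trans (measureU2 _ _ _))//.
    exact: measurableD.
  by rewrite [X in (X + _)%E]N'0 add0e.
have mU' : measurable U by exact: measurable_realfun.open_measurable.
(* [L] collects the intervals tagged by exceptional points. Measuring U on half-open intervals makes
   the third clause additive, so at the end the total length of [L] is below d and absolute
   continuity bounds the last sum by e. *)
pose P s t := exists L : seq (R * R),
  [/\ all (fun p : R * R => [&& s <= p.1, p.1 <= p.2 & p.2 <= t]) L,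
      chain L,
      ((\sum_(p <- L) (p.2 - p.1))%:E <= mu (U `&` `]s, t]))%E &
      `|y t - y s| <= (M + e) * (t - s) + \sum_(p <- L) `|y p.2 - y p.1|].
have [L [Lab Lc Lmu Ly]] : P a b.
  apply: cousin => // [r s t _ rs st _ [L [La Lc Lm Ly]]
      [K [Ka Kc Km Ky]]|c ac cb].
    exists (L ++ K); split.
    - rewrite all_cat; apply/andP; split.
        apply: sub_all La => p /and3P[-> -> ps]/=.
        exact: le_trans st.
      apply: sub_all Ka => p /and3P[sp -> ->]/=.
      by rewrite andbT (le_trans rs).
    - rewrite /chain pairwise_cat [X in _ && X]andbC; apply/and3P; split => //.
      apply/allrelP => p k /(allP La) /and3P[_ _ ps] /(allP Ka) /and3P[sk _ _].
      exact: le_trans sk.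
    - rewrite big_cat/= EFinD.
      have -> : U `&` `]r, t] = (U `&` `]r, s]) `|` (U `&` `]s, t]).
        rewrite -setIUr; congr (_ `&` _).
        apply/seteqP; split=> z /=; rewrite !in_itv/=.
          by move=> /andP[-> ->]; case: (leP z s) => _ /=; [left|right].
        by move=> [/andP[-> zs]|/andP[sz ->]] /=;
          rewrite ?(le_trans zs st) ?(le_lt_trans rs sz).
      rewrite measureU//; first exact: leeD.
      + exact: measurableI.
      + exact: measurableI.
      + apply/seteqP; split => // z [[_ +] [_]] /=.
        rewrite /= !in_itv/= => /andP[_ zs] /andP[/(le_lt_trans zs)].
        by rewrite ltxx.
    - rewrite big_cat/= -(subrKA (y s)); apply: le_trans (ler_normD _ _) _.
      by rewrite [X in X <= _]addrC; apply: le_trans (lerD Ly Ky) _; lra.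
  have [cN|cN] := pselect (N' c).
    have /nbhs_ballP[r /= r0 rU] : nbhs c U by apply: open_nbhs_nbhs; split => //; exact: NU.
    exists r => // s t as_ sc ct tb crs tcr.
    exists [:: (s, t)]; split => //=.
    - by rewrite lexx (le_trans sc ct) lexx.
    - rewrite big_seq1/=.
      have -> : U `&` `]s, t] = `]s, t]%classic.
        apply/setIidr => z /=; rewrite in_itv/= => /andP[sz zt].
        by apply: rU; rewrite /ball/= ltr_distlC; apply/andP; split; lra.
      rewrite lebesgue_measure_itv/= lte_fin -EFinB.
      case: ltP => // ts; rewrite lee_fin; lra.
    - rewrite big_seq1/= lerDr mulr_ge0//; last by rewrite subr_ge0 (le_trans sc).
      by rewrite addr_ge0// ltW.
  have cab : c \in `]a, b[.
    rewrite in_itv/= !lt_neqAle ac cb !andbT; apply/andP; split.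
      by apply/eqP => ac'; apply: cN; left; right.
    by apply/eqP => ac'; apply: cN; right.
  have [dc ydc dcM] : exists2 d, is_derive c 1 y d & `|d| <= M.
    apply: contrapT => H; apply: cN; left; left; apply: subN => /= /(_ cab).
    exact: H.
  have /nbhs_ballP[r /= r0 rU] := is_derive1_near ydc e0.
  exists r => // s t as_ sc ct tb crs tcr.
  exists [::]; split => //=.
    by rewrite big_nil.
  rewrite big_nil addr0 -(subrKA (y c)); apply: le_trans (ler_normD _ _) _.
  have -> : (M + e) * (t - s) = (M + e) * (t - c) + (M + e) * (c - s) by ring.
  have K z : ball c r z -> `|y z - y c| <= (M + e) * `|z - c|.
    move=> /rU/le_trans; apply; rewrite ler_wpM2r// lerD2r//.
  apply: lerD.
    rewrite -[t - c]ger0_norm ?subr_ge0//; apply: K.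
    by rewrite /ball/= ltr_distlC; apply/andP; split; lra.
  rewrite distrC -[c - s]ger0_norm ?subr_ge0// [`|c - s|]distrC; apply: K.
  rewrite /ball/= ltr_distlC; apply/andP; split; lra.
apply: (le_trans Ly); rewrite lerD2l; apply: ltW.
pose x0 : R * R := (a, a).
rewrite (big_nth x0) big_mkord.
apply: (yd (size L) (fun i => (nth x0 L i).1) (fun i => (nth x0 L i).2)).
- move=> i; have /(allP Lab)/and3P[] : nth x0 L i \in L by rewrite mem_nth.
  by [].
- move=> i j; rewrite neq_ltn => ij.
  move: Lc => /(pairwiseP x0) Lc.
  by case/orP: ij => ij; [left|right]; apply: Lc => //; rewrite inE.
- move: Lmu; rewrite (big_nth x0) big_mkord => Lmu.
  have Ud : (mu (U `&` `]a, b]) < d%:E)%E.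
    apply: le_lt_trans mUd; rewrite le_measure ?inE//; exact: measurableI.
  by move: (le_lt_trans Lmu Ud); rewrite lte_fin.
Qed.
End AbsolutelyContinuous.

(** * Integrals of almost everywhere ordered functions *)

Section AlmostEverywhereMonotone.
Local Open Scope ereal_scope.
Context d (T : measurableType d) (R : realType).
Variable mu : {measure set T -> \bar R}.
Import HBNNSimple.

(** A simple function below f is set to 0 on the null set where f may exceed g. It is then below g
    everywhere, because g is nonnegative, and its integral is unchanged. *)
Let le_ae_ereal_sup (f g : T -> \bar R) : (forall x, 0 <= g x) ->
  {ae mu, forall x, f x <= g x} ->
  ereal_sup [set sintegral mu h |
    h in [set h : {nnsfun T >-> R} | forall x, (h x)%:E <= f x]] <=
  ereal_sup [set sintegral mu h |
    h in [set h : {nnsfun T >-> R} | forall x, (h x)%:E <= g x]].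
Proof.
move=> g0 [N [mN N0 subN]].
apply: ge_ereal_sup => _ [h /= hf <-]; apply: ereal_sup_ubound.
exists (proj_nnsfun h (measurableC mN)).
  move=> x /=; rewrite mindicE in_setC; have [xN|xN] := boolP (x \in N).
    by rewrite mulr0.
  rewrite mulr1; apply: (le_trans (hf x)); apply: contrapT => fg.
  by move/negP: xN; apply; rewrite inE; exact: subN.
rewrite -!integralT_nnsfun; apply: ae_eq_integral => //.
- by apply/measurable_EFinP.
- by apply/measurable_EFinP.
- exists N; split => // x /= /not_implyP[_] hx; apply: contrapT => xN.
  by apply: hx; rewrite mindicE in_setC memNset// mulr1.
Qed.

(* The library integral is a difference of suprema over simple functions, so
   monotonicity needs no measurability of [f] and [g]. *)
Lemma le_ae_integral (D : set T) (f g : T -> \bar R) :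
  {ae mu, forall x, D x -> f x <= g x} ->
  \int[mu]_(x in D) f x <= \int[mu]_(x in D) g x.
Proof.
move=> fg; rewrite /integral.
have {}fg : {ae mu, forall x, (f \_ D) x <= (g \_ D) x}.
  apply: filterS fg => x; rewrite !patchE; case: ifPn => // /set_mem Dx.
  by apply.
apply: leeB; apply: le_ae_ereal_sup => //; apply: filterS fg => x fg.
- by rewrite !funeposE ge_max le_max fg/= le_max lexx orbT.
- by rewrite !funenegE ge_max le_max leeN2 fg/= le_max lexx orbT.
Qed.

Lemma eq_ae_integral (D : set T) (f g : T -> \bar R) :
  {ae mu, forall x, D x -> f x = g x} ->
  \int[mu]_(x in D) f x = \int[mu]_(x in D) g x.
Proof.
move=> fg; apply/le_anti/andP; split; apply: le_ae_integral;
by apply: filterS fg => x H Dx; rewrite H.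
Qed.

End AlmostEverywhereMonotone.

(** * Locally bounded measurable functions on the line *)

Section LocallyBounded.
Variable R : realType.
Local Notation mu := (@lebesgue_measure R).
Implicit Types (w : R -> R) (a b c t : R).

(** An algebra that contains the continuous functions and the components of the velocity, is stable
    under translation, and is integrable on every compact interval. Integrability conditions thus
    become closure properties. *)
Definition locally_bounded_measurable w : Prop :=
  measurable_fun setT w /\
  forall a b, exists K : R, forall t, a <= t -> t <= b -> `|w t| <= K.
Local Notation lbm := locally_bounded_measurable.

Lemma lbm_cst c : lbm (cst c).
Proof. by split=> // a b; exists `|c|. Qed.

Lemma lbmD w1 w2 : lbm w1 -> lbm w2 -> lbm (fun t => w1 t + w2 t).
Proof.
move=> [m1 b1] [m2 b2]; split; first exact: measurable_funD.
move=> a b; have [K1 H1] := b1 a b; have [K2 H2] := b2 a b.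
exists (K1 + K2) => t at_ tb; apply: le_trans (ler_normD _ _) _.
by rewrite lerD ?H1 ?H2.
Qed.

Lemma lbmM w1 w2 : lbm w1 -> lbm w2 -> lbm (fun t => w1 t * w2 t).
Proof.
move=> [m1 b1] [m2 b2]; split; first exact: measurable_funM.
move=> a b; have [K1 H1] := b1 a b; have [K2 H2] := b2 a b.
exists (K1 * K2) => t at_ tb; rewrite normrM.
by rewrite ler_pM ?H1 ?H2.
Qed.

Lemma lbmB w1 w2 : lbm w1 -> lbm w2 -> lbm (fun t => w1 t - w2 t).
Proof.
move=> l1 l2; have := lbmD l1 (lbmM (lbm_cst (-1)) l2).
by congr lbm; apply/funext => t; rewrite mulN1r.
Qed.

Lemma lbm_sum I (r : seq I) (F : I -> R -> R) :
  (forall i, lbm (F i)) -> lbm (fun t => \sum_(i <- r) F i t).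
Proof.
move=> HF; elim: r => [|i r IH].
  have := lbm_cst 0; congr lbm; apply/funext => t; by rewrite big_nil.
have := lbmD (HF i) IH; congr lbm; apply/funext => t; by rewrite big_cons.
Qed.

Lemma lbm_continuous w : continuous w -> lbm w.
Proof.
move=> cw; split; first exact: continuous_measurable_fun.
move=> a b; have [ab|ab] := leP a b; last first.
  by exists 0 => t at_ tb; have := le_lt_trans (le_trans at_ tb) ab; rewrite ltxx.
have cn : {within `[a, b], continuous (fun t => `|w t|)}.
  apply: continuous_subspaceT => t; apply: continuous_comp; first exact: cw.
  exact: norm_continuous.
have [c cab H] := EVT_max ab cn.
by exists `|w c| => t at_ tb; apply: H; rewrite in_itv/= at_.
Qed.

Lemma lbm_comp_shift w c : lbm w -> lbm (fun t => w (c + t)).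
Proof.
move=> [mw bw]; split.
  apply: measurableT_comp => //; apply: measurable_funD => //.
move=> a b; have [K HK] := bw (c + a) (c + b).
by exists K => t at_ tb; apply: HK; rewrite lerD2l.
Qed.

Lemma lbm_integrable w a b : lbm w -> mu.-integrable `[a, b] (EFin \o w).
Proof.
move=> [mw bw]; apply: measurable_bounded_integrable => //.
- by apply: (le_lt_trans (_ : _ <= mu (`[a, b]%classic : set R)))%E => //;
  rewrite lebesgue_measure_itv/=; case: ifPn; rewrite ?ltry// -EFinB ltry.
- exact: measurable_funTS.
- have [K HK] := bw a b; exists K; split => [|x Kx t /=].
    exact: num_real.
  by rewrite in_itv/= => /andP[at_ tb]; rewrite (le_trans (HK _ at_ tb))// ltW.
Qed.

Lemma Rintegral_itv_split w a b c : lbm w -> a <= b -> b <= c ->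
  \int[mu]_(t in `[a, c]) w t =
  \int[mu]_(t in `[a, b]) w t + \int[mu]_(t in `[b, c]) w t.
Proof.
move=> lw ab bc; apply/eqP; rewrite addrC -subr_eq; apply/eqP.
rewrite Rintegral_itvB; first last.
- by rewrite bnd_simp.
- by rewrite bnd_simp.
- exact: lbm_integrable.
rewrite Rintegral_itv_obnd_cbnd//.
apply: (@integrableS _ _ _ _ _ _ _ _ _ _ (@lbm_integrable w b c lw)) => //.
exact: subset_itv_oc_cc.
Qed.

Lemma Rintegral_itv_le w a b K : lbm w -> a <= b ->
  (forall t, a <= t -> t <= b -> `|w t| <= K) ->
  `|\int[mu]_(t in `[a, b]) w t| <= K * (b - a).
Proof.
move=> lw ab wK.
apply: le_trans (le_normr_Rintegral _ _) _ => //; first exact: lbm_integrable.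
apply: (@le_trans _ _ (\int[mu]_(t in `[a, b]) K)).
  apply: le_Rintegral => //.
  - exact: integrable_norm (@lbm_integrable w a b lw).
  - exact: lbm_integrable (lbm_cst K).
  - by move=> t; rewrite /= in_itv/= => /andP[]; exact: wK.
rewrite Rintegral_cst// [X in fine X]lebesgue_measure_itv/= lte_fin.
case: ifPn => //; rewrite -leNgt => ba.
have -> : b = a by apply/le_anti/andP.
by rewrite subrr.
Qed.

(** The push-forward under the translation has the value of Lebesgue measure on half-open intervals,
    so uniqueness applies. *)
Lemma lebesgue_measureDl c (A : set R) : measurable A ->
  mu ((fun t => c + t) @^-1` A) = mu A.
Proof.
move=> mA.
have mc : measurable_fun setT
    (fun t : measurableTypeR R => (c + t : measurableTypeR R)).
  exact: measurable_funD.
rewrite -[LHS]/(pushforward mu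
  (fun t : measurableTypeR R => (c + t : measurableTypeR R)) A).
apply/esym/lebesgue_measure_unique => //= _ [[a b]] _ <-.
rewrite /pushforward.
have -> : (fun t => c + t) @^-1` `]a, b]%classic = `]a - c, b - c]%classic.
  by apply/seteqP; split => t /=; rewrite !in_itv/= ltrBlDl lerBrDl.
rewrite !lebesgue_measure_itv/= !lte_fin ltrD2r.
by case: ifPn => // _; rewrite -!EFinB; congr (_%:E); ring.
Qed.

Lemma Rintegral_comp_shift w a b c : lbm w ->
  \int[mu]_(t in `[a, b]) w (c + t) = \int[mu]_(t in `[c + a, c + b]) w t.
Proof.
move=> lw; rewrite /Rintegral; congr fine.
have mc : measurable_fun setT
    (fun t : measurableTypeR R => (c + t : measurableTypeR R)).
  exact: measurable_funD.
have E : `[a, b]%classic =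
    (fun t : measurableTypeR R => (c + t : measurableTypeR R))
      @^-1` `[c + a, c + b].
  by apply/seteqP; split => t /=; rewrite !in_itv/= !lerD2l.
rewrite [in LHS]E -(@integral_pushforward _ _ _ _ _ _ mc mu _ (EFin \o w))//.
- by apply: eq_measure_integral => A mA _; exact: lebesgue_measureDl.
- by apply/measurable_EFinP; exact: lw.1.
- by rewrite -E; exact: lbm_integrable (lbm_comp_shift _ lw).
Qed.

End LocallyBounded.

(** * The fundamental theorem of calculus for Lipschitz functions *)

Section Primitive.
Variable R : realType.
Local Notation mu := (@lebesgue_measure R).
Local Notation lbm := (@locally_bounded_measurable R).
Implicit Types (w : R -> R) (a b c s t : R).

Lemma is_derive_comp_shift (V : normedModType R) (y : R -> V) s t (d : V) :
  is_derive (t + s) 1 y d -> is_derive t 1 (fun t => y (t + s)) d.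
Proof.
move=> [dy dE].
suff E : (fun h : R =>
      h^-1 *: (((fun t => y (t + s)) \o shift t) (h *: 1) - y (t + s))) =
    (fun h : R => h^-1 *: ((y \o shift (t + s)) (h *: 1) - y (t + s))).
  apply: DeriveDef; first by rewrite /derivable E.
  by rewrite -dE /derive E.
by apply/funext => h /=; rewrite addrA.
Qed.

Lemma derive_continuous (V : normedModType R) (y : R -> V) t (d : V) :
  is_derive t 1 y d -> {for t, continuous y}.
Proof.
by move=> [dy _]; apply: differentiable_continuous; exact/derivable1_diffP.
Qed.

(** Cousin's lemma: a short interval around c splits at c, where the two bounds add up. Only
    comparisons with the centre c are required. *)
Lemma local_lipschitz_on (V : normedModType R) (y : R -> V) a b (K : R) :
  (forall c, a <= c -> c <= b -> exists2 e, 0 < e &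
    forall t, a <= t -> t <= b -> `|t - c| < e ->
      `|y t - y c| <= K * `|t - c|) ->
  forall s t, a <= s -> s <= t -> t <= b -> `|y t - y s| <= K * (t - s).
Proof.
move=> yloc s t as_ st tb.
apply: (@cousin R (fun s t => `|y t - y s| <= K * (t - s)) s t) => //.
  move=> p q r _ _ _ _ pq qr; rewrite -(subrKA (y q)).
  apply: le_trans (ler_normD _ _) _.
  by rewrite -(subrKA q r (- p)) mulrDr lerD.
move=> c sc ct.
have ac : a <= c by apply: le_trans sc.
have cb : c <= b by apply: le_trans tb.
have [e e0 yc] := yloc c ac cb.
exists e => // p q sp pc cq qt pe qe.
rewrite -(subrKA (y c)); apply: le_trans (ler_normD _ _) _.
rewrite -(subrKA c q (- p)) mulrDr lerD//.
  rewrite -[q - c]ger0_norm ?subr_ge0//; apply: yc; try lra.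
  by rewrite ger0_norm; lra.
rewrite distrC -[c - p]ger0_norm ?subr_ge0// (distrC c); apply: yc; try lra.
by rewrite distrC ger0_norm; lra.
Qed.

Lemma derive_lipschitz_on (V : normedModType R) (y dy : R -> V) a b (K : R) :
  (forall t, a <= t -> t <= b -> is_derive t 1 y (dy t)) ->
  (forall t, a <= t -> t <= b -> `|dy t| <= K) ->
  forall s t, a <= s -> s <= t -> t <= b -> `|y t - y s| <= (K + 1) * (t - s).
Proof.
move=> yd dyK; apply: local_lipschitz_on => c ac cb.
have /nbhs_ballP[e /= e0 H] := is_derive1_near (yd c ac cb) ltr01.
exists e => // t at_ tb tce; apply: le_trans (H _ _) _.
  by rewrite /ball/= distrC.
by rewrite ler_wpM2r// lerD2r dyK.
Qed.

Let Rintegral_itv_rev w a b : b <= a -> \int[mu]_(t in `[a, b]) w t = 0.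
Proof.
rewrite le_eqVlt => /predU1P[->|ba].
  by rewrite set_itv1 Rintegral_set1.
by rewrite set_itv_ge ?Rintegral_set0// bnd_simp -ltNge.
Qed.

(* The oriented integral from 0 to [t]: one of the two intervals is empty or a
   point. *)
Definition primitive w t : R :=
  \int[mu]_(s in `[0, t]) w s - \int[mu]_(s in `[t, 0]) w s.

Lemma primitiveB w a b : lbm w -> a <= b ->
  primitive w b - primitive w a = \int[mu]_(t in `[a, b]) w t.
Proof.
move=> lw ab; rewrite /primitive.
have [b0|b0] := leP b 0.
  rewrite (Rintegral_itv_rev w b0) (Rintegral_itv_rev w (le_trans ab b0)).
  by rewrite (Rintegral_itv_split lw ab b0); ring.
have [a0|a0] := leP 0 a.
  rewrite (Rintegral_itv_rev w a0) (Rintegral_itv_rev w (ltW b0)).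
  by rewrite (Rintegral_itv_split lw a0 ab); ring.
rewrite (Rintegral_itv_rev w (ltW a0)) (Rintegral_itv_rev w (ltW b0)).
by rewrite (Rintegral_itv_split lw (ltW a0) (ltW b0)); ring.
Qed.

Let primitive_near w t F : lbm w ->
  F = (fun x => \int[mu]_(s in `[t - 1, x]) w s) ->
  \forall x \near t, primitive w (t - 1) + F x = primitive w x.
Proof.
move=> lw ->; near=> x.
rewrite -primitiveB//; first by rewrite addrC subrK.
apply: ltW; near: x; apply: lt_nbhsr.
by rewrite ltrBlDr ltrDl.
Unshelve. all: by end_near. Qed.

Lemma is_derive_primitive w t : continuous w ->
  is_derive t 1 (primitive w) (w t).
Proof.
move=> cw; have lw := lbm_continuous cw.
have tt1 : t < t + 1 by rewrite ltrDl.
have t1t : t - 1 < t by rewrite ltrBlDr ltrDl.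
(* The base point t - 1 lies to the left of t; near t this integral differs from [primitive w] by a
   constant. *)
have [] := continuous_FTC1_closed tt1 (@lbm_integrable R w (t - 1) (t + 1) lw) t1t (cw t).
set F := (fun x => \int[mu]_(s in `[t - 1, x]) w s) => dF FE.
have dF' : is_derive t 1 F (w t) by rewrite -FE derive1E; exact/derivableP.
apply: (near_eq_is_derive (primitive_near lw erefl)).
rewrite -[X in is_derive _ _ _ X]add0r.
exact: is_deriveD (is_derive_cst _ _ _) dF'.
Qed.

Lemma ae_is_derive_primitive w a : lbm w ->
  {ae mu, forall t, a < t -> is_derive t 1 (primitive w) (w t)}.
Proof.
move=> lw.
have li : locally_integrable [set: R] w.
  split => //; first exact: lw.1.
    exact: openT.
  move=> K _ cK.
  have [M [_ KM]] := compact_bounded cK.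
  have KM' : K `<=` `[- (M + 1), M + 1]%classic.
    move=> t Kt /=; have := KM (M + 1) _ t Kt.
    by rewrite ltrDl => /(_ ltr01); rewrite in_itv/= ler_norml.
  have := @integrableS _ _ _ _ _ _ _ _ _ _ (@lbm_integrable _ w (- (M + 1)) (M + 1) lw).
  by move=> /(_ K _ (compact_measurable cK) KM') /integrableP[].
have := @FTC1 R w (BLeft a) (fun y => @lbm_integrable _ w a y lw) li.
set F := (fun x => \int[mu]_(s in `[a, x]) w s) => dFE.
move: dFE; apply: filterS; first exact: (ae_filter_ringOfSetsType mu).
move=> t + at_ => /(_ at_)[dF FE].
have dF' : is_derive t 1 F (w t) by rewrite -FE derive1E; exact/derivableP.
suff : \forall x \near t, primitive w a + \int[mu]_(s in `[a, x]) w s = primitive w x.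
  move=> /near_eq_is_derive; apply.
  rewrite -[X in is_derive _ _ _ X]add0r.
  exact: is_deriveD (is_derive_cst _ _ _) dF'.
near=> x.
rewrite -primitiveB//; first by rewrite addrC subrK.
by apply: ltW; near: x; apply: lt_nbhsr.
Unshelve. all: by end_near. Qed.

Lemma primitive_lipschitz_on w a b : lbm w -> exists2 K, 0 <= K &
  forall s t, a <= s -> s <= t -> t <= b ->
    `|primitive w t - primitive w s| <= K * (t - s).
Proof.
move=> lw; have [K wK] := lw.2 a b; exists `|K| => // s t as_ st tb.
rewrite primitiveB// Rintegral_itv_le// => r sr rt.
apply: le_trans (ler_norm K); apply: wK.
  exact: le_trans sr.
exact: le_trans tb.
Qed.

(** The difference between F and [primitive w] is Lipschitz with derivative 0 almost everywhere, so
    [absolutely_continuous_le] with M = 0 makes it constant. *)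
Lemma lipschitz_FTC (F w : R -> R) a b (K : R) : a <= b -> lbm w ->
  (forall s t, a <= s -> s <= t -> t <= b -> `|F t - F s| <= K * (t - s)) ->
  {ae mu, forall t, t \in `]a, b[ -> is_derive t 1 F (w t)} ->
  F b - F a = \int[mu]_(t in `[a, b]) w t.
Proof.
move=> ab lw FK dF; rewrite -primitiveB//.
have [L L0 wL] := primitive_lipschitz_on a b lw.
apply/eqP; rewrite -subr_eq0 -normr_le0 -[X in _ <= X](mul0r (b - a)).
have -> : F b - F a - (primitive w b - primitive w a) =
    (F b - primitive w b) - (F a - primitive w a) by ring.
apply: (@absolutely_continuous_le R R^o (fun t => F t - primitive w t) a b 0) => //.
  (* The sign of K is not assumed, hence the absolute value; the 1 keeps the denominator
     positive. *)
  move=> e e0; exists (e / (`|K| + L + 1)).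
    by rewrite divr_gt0//; have := normr_ge0 K; lra.
  move=> p l r lr _; rewrite ltr_pdivlMr; last by have := normr_ge0 K; lra.
  apply: le_lt_trans; rewrite mulr_suml ler_sum// => i _.
  have [al lri rb] := lr i.
  have -> : F (r i) - primitive w (r i) - (F (l i) - primitive w (l i)) =
    (F (r i) - F (l i)) - (primitive w (r i) - primitive w (l i)) by ring.
  apply: le_trans (ler_normB _ _) _.
  apply: le_trans (lerD (FK _ _ al lri rb) (wL _ _ al lri rb)) _.
  rewrite -mulrDl mulrC ler_wpM2l ?subr_ge0//.
  by have := ler_norm K; lra.
move: dF (ae_is_derive_primitive a lw).
apply: filterS2; first exact: (ae_filter_ringOfSetsType mu).
move=> t dF dw tab.
exists 0; last by rewrite normr0.
rewrite -(subrr (w t)); apply: is_deriveB; first exact: dF.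
by apply: dw; move: tab; rewrite in_itv/= => /andP[].
Qed.

Lemma derive_FTC (F w : R -> R) a b : a <= b -> continuous w ->
  (forall t, is_derive t 1 F (w t)) ->
  F b - F a = \int[mu]_(t in `[a, b]) w t.
Proof.
move=> ab cw dF; rewrite -(primitiveB (lbm_continuous cw))//.
have := @is_derive_0_is_cst R (fun t => F t - primitive w t) b a.
suff H t : is_derive t 1 (fun t => F t - primitive w t) 0.
  by move=> /(_ H) E; apply/eqP; rewrite subr_eq; apply/eqP; lra.
rewrite -(subrr (w t)); apply: is_deriveB; exact: is_derive_primitive.
Qed.

End Primitive.

(** * Moments of a translated function against a polynomial *)

Section PolynomialConvolution.
Variable R : realType.
Local Notation mu := (@lebesgue_measure R).
Local Notation lbm := (@locally_bounded_measurable R).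
Implicit Types (p : {poly R}) (y w : R -> R) (a b c s t : R).

Lemma continuous_comp_shift (V : topologicalType) (y : R -> V) c :
  continuous y -> continuous (fun t => y (c + t)).
Proof.
move=> cy t; apply: (@continuous_comp _ _ _ (fun t => c + t) y); last exact: cy.
by apply: cvgD; [exact: cvg_cst|exact: cvg_id].
Qed.

Lemma lbm_poly p : lbm (horner p).
Proof. exact/lbm_continuous/continuous_horner. Qed.

(** The derivative moves onto the polynomial and y is replaced by its primitive, so continuity of y
    suffices. *)
Lemma Rintegral_poly_parts p y a b t : a <= b -> continuous y ->
  \int[mu]_(s in `[a, b]) (p.[s] * y (t + s)) =
  p.[b] * primitive y (t + b) - p.[a] * primitive y (t + a)
  - \int[mu]_(s in `[a, b]) (p^`().[s] * primitive y (t + s)).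
Proof.
move=> ab cy; set Y := primitive y.
have dY s : is_derive s 1 (fun s => Y (t + s)) (y (t + s)).
  have -> : (fun s => Y (t + s)) = (fun s => Y (s + t)).
    by apply/funext => r; rewrite addrC.
  by rewrite [t + s]addrC; apply: is_derive_comp_shift; exact: is_derive_primitive.
have cyt : continuous (fun s => y (t + s)) by exact: continuous_comp_shift.
have cY : continuous (fun s => Y (t + s)).
  by move=> s; exact: derive_continuous (dY s).
pose w s := p^`().[s] * Y (t + s) + p.[s] * y (t + s).
have /(_ ab) -> //: a <= b -> p.[b] * Y (t + b) - p.[a] * Y (t + a) =
    \int[mu]_(s in `[a, b]) w s.
  move=> _; apply: (@derive_FTC R (fun s => p.[s] * Y (t + s))) => //.
    move=> s; apply: cvgD; apply: cvgM; try exact: continuous_horner.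
      exact: cY.
    exact: cyt.
  move=> s; apply: (is_derive_eq (is_deriveM (is_derive_poly p s) (dY s))).
  rewrite /w [LHS]addrC; congr (_ + _).
  by rewrite [LHS]mulrC.
rewrite /w RintegralD//; first by rewrite addrAC subrr add0r.
  apply: lbm_integrable; apply: lbmM; [exact: lbm_poly|exact: lbm_continuous].
apply: lbm_integrable; apply: lbmM; [exact: lbm_poly|exact: lbm_continuous].
Qed.

(* The induction lowers the degree of [p] by integrating by parts against a
   primitive of [y]; differentiability of [y] is not needed. *)
Lemma is_derive_poly_conv p y a b t : a <= b -> continuous y ->
  is_derive t 1 (fun t => \int[mu]_(s in `[a, b]) (p.[s] * y (t + s)))
    (p.[b] * y (t + b) - p.[a] * y (t + a)
     - \int[mu]_(s in `[a, b]) (p^`().[s] * y (t + s))).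
Proof.
move=> ab; move: {2}(size p) (leqnn (size p)) => k.
elim: k p y t => [|k IH] p y t pk cy.
  move: pk; rewrite leqn0 size_poly_eq0 => /eqP ->.
  have Z (z : R -> R) : \int[mu]_(s in `[a, b]) ((0 : {poly R}).[s] * z s) = 0.
    by under eq_Rintegral do rewrite horner0 mul0r; rewrite Rintegral_cst// mul0r.
  rewrite deriv0 Z !horner0 !mul0r !subr0.
  by under eq_fun do rewrite Z; exact: is_derive_cst.
have dY s : is_derive s 1 (primitive y) (y s) by exact: is_derive_primitive.
have cY : continuous (primitive y) by move=> s; exact: derive_continuous (dY s).
have pk' : (size p^`() <= k)%N.
  have [->|p0] := eqVneq p 0; first by rewrite deriv0 size_poly0.
  by rewrite -ltnS (leq_trans (lt_size_deriv p0)).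
under eq_fun do rewrite (Rintegral_poly_parts p _ ab cy).
rewrite (Rintegral_poly_parts p^`() _ ab cy).
apply: is_deriveB; last exact: IH.
have := @is_deriveB _ _ _
  (fun t => p.[b] * primitive y (t + b)) (fun t => p.[a] * primitive y (t + a)).
apply.
  by apply: is_deriveZ; apply: is_derive_comp_shift.
by apply: is_deriveZ; apply: is_derive_comp_shift.
Qed.

Lemma lipschitzM (F G : R -> R) a b (K L A B : R) :
  (forall t, a <= t -> t <= b -> `|F t| <= A) ->
  (forall t, a <= t -> t <= b -> `|G t| <= B) ->
  (forall s t, a <= s -> s <= t -> t <= b -> `|F t - F s| <= K * (t - s)) ->
  (forall s t, a <= s -> s <= t -> t <= b -> `|G t - G s| <= L * (t - s)) ->
  forall s t, a <= s -> s <= t -> t <= b ->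
    `|F t * G t - F s * G s| <= (A * L + K * B) * (t - s).
Proof.
move=> FA GB FK GL s t as_ st tb.
have at_ : a <= t by apply: le_trans st.
have sb : s <= b by apply: le_trans tb.
have -> : F t * G t - F s * G s = F t * (G t - G s) + (F t - F s) * G s by ring.
apply: le_trans (ler_normD _ _) _; rewrite !normrM mulrDl.
apply: lerD.
  by rewrite -mulrA ler_pM// ?FA// ?GL.
by rewrite mulrAC ler_pM// ?FK// ?GB.
Qed.

(** Turns moments of the velocity, defined almost everywhere, into boundary values and moments of
    the state. *)
Lemma Rintegral_poly_lipschitz_parts p (X v : R -> R) (A B K : R) a b t :
  a <= b -> A <= t + a -> t + b <= B -> continuous X -> lbm v ->
  (forall s t, A <= s -> s <= t -> t <= B -> `|X t - X s| <= K * (t - s)) ->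
  {ae mu, forall t, t \in `]A, B[ -> is_derive t 1 X (v t)} ->
  \int[mu]_(s in `[a, b]) (p.[s] * v (t + s)) =
  p.[b] * X (t + b) - p.[a] * X (t + a)
  - \int[mu]_(s in `[a, b]) (p^`().[s] * X (t + s)).
Proof.
move=> ab Ata tbB cX lv XK dX.
have lX := lbm_continuous cX.
(* The regularity of X is stated in absolute time, so p is translated to that time; the integral is
   shifted back at the end. *)
pose q := p \Po ('X - t%:P).
have qE s : q.[s] = p.[s - t] by rewrite /q horner_comp !hornerE.
have q'E s : q^`().[s] = p^`().[s - t].
  by rewrite /q deriv_comp derivB derivX derivC subr0 mulr1 horner_comp !hornerE.
pose w s := q^`().[s] * X s + q.[s] * v s.
have lw : lbm w by apply: lbmD; apply: lbmM => //; exact: lbm_poly.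
have tab : t + a <= t + b by rewrite lerD2l.
have [Q HQ] := (lbm_poly q).2 (t + a) (t + b).
have [Q' HQ'] := (lbm_poly q^`()).2 (t + a) (t + b).
have [M HM] := lX.2 (t + a) (t + b).
have E : q.[t + b] * X (t + b) - q.[t + a] * X (t + a) =
    \int[mu]_(s in `[t + a, t + b]) w s.
  apply: (@lipschitz_FTC R (fun s => q.[s] * X s) w _ _ (Q * K + (Q' + 1) * M)) => //.
    apply: lipschitzM => //.
      apply: (@derive_lipschitz_on R R (horner q) (horner q^`())) => //.
    by move=> s r ts sr rt; apply: XK => //; [exact: le_trans ts|exact: le_trans tbB].
  move: dX; apply: filterS; first exact: (ae_filter_ringOfSetsType mu).
  move=> s dX; rewrite in_itv/= => /andP[as_ sb].
  have /dX dXs : s \in `]A, B[.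
    by rewrite in_itv/= (le_lt_trans Ata)// (lt_le_trans sb).
  apply: (is_derive_eq (is_deriveM (is_derive_poly q s) dXs)).
  rewrite /w [LHS]addrC; congr (_ + _).
  by rewrite [LHS]mulrC.
rewrite !qE in E; rewrite [t + b - t]addrAC subrr add0r [t + a - t]addrAC subrr add0r in E.
rewrite E -(Rintegral_comp_shift _ _ _ lw) /w.
under [in RHS]eq_Rintegral do rewrite qE q'E addrAC subrr add0r.
rewrite RintegralD//; first by rewrite addrAC subrr add0r.
  by apply: lbm_integrable; apply: lbmM; [exact: lbm_poly|exact: lbm_comp_shift].
by apply: lbm_integrable; apply: lbmM; [exact: lbm_poly|exact: lbm_comp_shift].
Qed.

End PolynomialConvolution.

(** * Legendre polynomials *)

Section LegendrePolynomials.
Variable R : realType.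
Implicit Types (p q : {poly R}) (k j : nat).

(* Rodrigues' formula, on [0, 1]. *)
Definition legendre_poly k : {poly R} := nderivn k (('X^2 - 'X) ^+ k).

Let w : {poly R} := 'X^2 - 'X.

Let derivn_legendre k : derivn k (w ^+ k) = legendre_poly k *+ k`!.
Proof. exact: nderivn_def. Qed.

(** Identifies Rodrigues' formula with the explicit sum of [legendre]: expand (X^2 - X)^k = (-1)^k
    X^k (1 - X)^k; the normalized k-th derivative sends X^(k+l) to the binomial coefficient of k + l
    over l times X^l. *)
Lemma horner_legendre_poly k z : (legendre_poly k).[z] =
  (-1) ^+ k * \sum_(l < k.+1)
    (-1) ^+ l * 'C(k, l)%:R * 'C(k + l, l)%:R * z ^+ l.
Proof.
rewrite /legendre_poly.
have -> : ('X^2 - 'X : {poly R}) ^+ k =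
    (-1) ^+ k *: \sum_(l < k.+1) ((-1) ^+ l * 'C(k, l)%:R) *: 'X^(k + l).
  have -> : 'X^2 - 'X = -1 *: ('X * (1 - 'X)) :> {poly R} by rewrite scaleN1r; ring.
  rewrite exprZn exprMn; congr (_ *: _).
  rewrite exprBn mulr_sumr; apply: eq_bigr => l _.
  rewrite expr1n mulr1 exprD -mulr_natr -mul_polyC rmorphM rmorphXn rmorphN.
  by rewrite rmorph1 rmorph_nat; ring.
rewrite linearZ linear_sum hornerZ horner_sum; congr (_ * _).
apply: eq_bigr => l _; rewrite linearZ/= nderivnXn hornerZ hornerMn hornerXn.
rewrite addKn -[X in _ * X]mulr_natr.
rewrite -(@bin_sub (k + l) l) ?leq_addl// addnK.
by ring.
Qed.

(** At c, only the term in which all k derivatives fall on the power survives. This gives the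
    endpoint values of the Legendre polynomials, since [w] has simple zeros at 0 and 1. *)
Let derivn_horner_center c k q :
  (derivn k (('X - c%:P) ^+ k * q)).[c] = q.[c] *+ k`!.
Proof.
elim: k q => [|k IH] q; first by rewrite expr0 mul1r.
have -> : derivn k.+1 (('X - c%:P) ^+ k.+1 * q) =
    derivn k (('X - c%:P) ^+ k * (q *+ k.+1 + ('X - c%:P) * q^`())).
  rewrite derivSn derivM deriv_exp derivXsubC mul1r; congr (derivn k _).
  by rewrite exprSr/= -mulr_natr -[q *+ _]mulr_natr; ring.
rewrite IH hornerD hornerMn hornerM hornerXsubC subrr mul0r addr0.
by rewrite -mulrnA factS.
Qed.

Let natr_neq0 n : n.+1%:R != 0 :> R.
Proof. by rewrite pnatr_eq0. Qed.

Let mulfact_inj k (x y : R) : x *+ k`! = y *+ k`! -> x = y.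
Proof.
rewrite -[x *+ _]mulr_natr -[y *+ _]mulr_natr => /mulIf; apply.
by rewrite pnatr_eq0 -lt0n fact_gt0.
Qed.

Lemma legendre_poly0 k : (legendre_poly k).[0] = (-1) ^+ k.
Proof.
apply: (@mulfact_inj k); rewrite -hornerMn -derivn_legendre.
have -> : w ^+ k = ('X - 0%:P) ^+ k * ('X - 1) ^+ k.
  by rewrite -exprMn; congr (_ ^+ _); rewrite /w subr0; ring.
by rewrite derivn_horner_center horner_exp; congr (_ ^+ _ *+ _); rewrite !hornerE.
Qed.

Lemma legendre_poly1 k : (legendre_poly k).[1] = 1.
Proof.
apply: (@mulfact_inj k); rewrite -hornerMn -derivn_legendre.
have -> : w ^+ k = ('X - 1%:P) ^+ k * 'X ^+ k.
  by rewrite -exprMn; congr (_ ^+ _); rewrite /w; ring.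
by rewrite derivn_horner_center horner_exp hornerX expr1n.
Qed.

Lemma size_legendre_poly k : (size (legendre_poly k) <= k.+1)%N.
Proof.
apply: leq_trans (size_poly _ _) _; rewrite leq_subLR.
apply: leq_trans (size_poly_exp_leq _ _) _.
rewrite addnS ltnS.
have sw : (size w <= 3)%N.
  apply: leq_trans (size_polyD _ _) _.
  by rewrite size_polyXn size_polyN size_polyX.
by rewrite addnn -mul2n leq_mul2r; apply/orP; right; rewrite -ltnS; case: size sw.
Qed.

(** Since w'^2 = 4 w + 1 and w'' = 2, the second derivative of w^(k+2) is a combination of w^(k+1)
    and w^k. Differentiating k + 1 more times and dividing by (k+2)! gives the recurrence. *)
Lemma deriv_legendre_poly_rec k :
  (legendre_poly k.+2)^`() =
  (4 * k + 6)%:R *: legendre_poly k.+1 + (legendre_poly k)^`().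
Proof.
have E : (w ^+ k.+2)^`()^`() =
    (k.+2 * (4 * k + 6))%:R *: w ^+ k.+1 + (k.+2 * k.+1)%:R *: w ^+ k.
  have dw : w^`() = 2%:R *: 'X - 1.
    by rewrite /w derivB derivXn derivX/= -mulr_natr -mul_polyC rmorph_nat; ring.
  have ddw : w^`()^`() = 2%:R.
    by rewrite dw derivB derivZ derivX derivC subr0 -mul_polyC rmorph_nat mulr1.
  have dw2 : w^`() * w^`() = 4%:R * w + 1.
    by rewrite dw -mul_polyC rmorph_nat /w; ring.
  rewrite deriv_exp/= derivMn derivM deriv_exp/= ddw.
  rewrite mulrnAr mulrA dw2 exprS.
  rewrite -[_ *: w ^+ k]mul_polyC -[_ *: (w * _)]mul_polyC !rmorph_nat.
  move: (w ^+ k) => W.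
  rewrite -[_ *+ k.+1]mulr_natr -[_ *+ k.+2]mulr_natr !natrM natrD natrM.
  by ring.
have D2 : (legendre_poly k.+2)^`() *+ k.+2`! =
    derivn k.+1 (w ^+ k.+2)^`()^`().
  by rewrite -derivMn -derivn_legendre -derivnS !derivSn.
have D0 : derivn k.+1 (w ^+ k) = (legendre_poly k)^`() *+ k`!.
  by rewrite derivnS derivn_legendre derivMn.
apply: (scalerI (_ : (k.+2`!)%:R != 0)).
  by rewrite pnatr_eq0 -lt0n fact_gt0.
rewrite scaler_nat D2 E derivnD !derivnZ D0 derivn_legendre.
rewrite -[_ *+ k.+1`!]scaler_nat -[_ *+ k`!]scaler_nat !scalerA scalerDr scalerA.
rewrite -!natrM.
by congr (_%:R *: _ + _%:R *: _); rewrite ?factS; ring.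
Qed.

(** The recurrence unrolled in steps of two: the factor 1 - (-1)^(k+j) is 2 when j and k have
    opposite parity and 0 otherwise. *)
Lemma deriv_legendre_poly k :
  (legendre_poly k)^`() =
  \sum_(j < k) ((2 * j + 1)%:R * (1 - (-1) ^+ (k + j))) *: legendre_poly j.
Proof.
have [n] := ubnP k; elim: n k => // n IH [|[|k]] kn.
- by rewrite big_ord0 /legendre_poly expr0 nderivn0 derivC.
- rewrite big_ord1 /legendre_poly expr1 expr0 nderivn0 nderivn1.
  rewrite derivB derivXn !derivX derivB derivMn derivX derivC subr0/=.
  by rewrite expr1 opprK -scaler_nat; congr (_ *: _); ring.
rewrite deriv_legendre_poly_rec IH; last by rewrite ltnW.
rewrite !big_ord_recr/= -addrA addrC; congr (_ + _); last first.
  by apply: eq_bigr => j _; rewrite !addSn !exprS mulrA mulrN1 opprK mul1r.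
have s1 : (-1) ^+ (k.+2 + k) = 1 :> R.
  by rewrite -signr_odd oddD /= negbK addbb.
have s2 : (-1) ^+ (k.+2 + k.+1) = -1 :> R.
  by rewrite -signr_odd oddD /= negbK addbN addbb.
rewrite s1 s2 subrr mulr0 scale0r add0r.
by congr (_ *: _); ring.
Qed.

(** This is where the coefficients of [Gamma_row] come from. The case j = k, which [gammac] admits,
    contributes 0 by parity, and the terms with j > k are 0 by definition. *)
Lemma deriv_legendre_poly_gamma (N k : nat) : (k <= N)%N ->
  (legendre_poly k)^`() = - \sum_(j < N) gammac R k j *: legendre_poly j.
Proof.
move=> kN; rewrite deriv_legendre_poly -sumrN.
rewrite (big_ord_widen N
  (fun j => ((2 * j + 1)%:R * (1 - (-1) ^+ (k + j))) *: legendre_poly j))//.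
rewrite big_mkcond; apply: eq_bigr => j _; rewrite /gammac.
case: (ltngtP k j) => [_|_|kj]; rewrite ?scale0r ?oppr0 ?scaleNr ?opprK//.
by rewrite kj -signr_odd oddD addbb subrr mulr0 scale0r.
Qed.

Section Orthogonality.
(** J stands for integration over [0, 1]. Linearity and the value on derivatives are all that
    orthogonality requires, so the argument is purely algebraic. *)
Variable J : {poly R} -> R.
Hypothesis JD : forall p q, J (p + q) = J p + J q.
Hypothesis JZ : forall c p, J (c *: p) = c * J p.
Hypothesis J_deriv : forall p, J p^`() = p.[1] - p.[0].

Let J0 : J 0 = 0. Proof. by rewrite -(scale0r 0) JZ mul0r. Qed.

(* (4k + 2) P_k is the derivative of P_{k+1} - P_{k-1}, which vanishes at 0
   and 1, so the degree of [p] can be lowered by parts. *)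
Lemma legendre_poly_orthogonal_low k p : (size p <= k)%N ->
  J (legendre_poly k * p) = 0.
Proof.
move: {2}(size p) (leqnn (size p)) => d.
elim: d k p => [|d IH] k p pd pk.
  by move: pd; rewrite leqn0 size_poly_eq0 => /eqP ->; rewrite mulr0.
have p'd : (size p^`() <= d)%N.
  have [->|p0] := eqVneq p 0; first by rewrite deriv0 size_poly0.
  by rewrite -ltnS (leq_trans (lt_size_deriv p0)).
have [->|p0] := eqVneq p 0; first by rewrite mulr0.
have p'k : (size p^`() < k)%N by rewrite (leq_trans (lt_size_deriv p0)).
pose q := if k is k'.+1 then legendre_poly k.+1 - legendre_poly k' else 0.
have [q' q1 q0 Jq] : [/\ q^`() = (4 * k + 2)%:R *: legendre_poly k,
    q.[1] = 0, q.[0] = 0 & J (q * p^`()) = 0].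
  rewrite /q; case: k {q pk} p'k => // k p'k; split.
  - by rewrite derivB deriv_legendre_poly_rec addrK; congr (_%:R *: _); ring.
  - by rewrite !hornerE !legendre_poly1 subrr.
  - by rewrite !hornerE !legendre_poly0 !exprS; ring.
  - rewrite mulrBl -scaleN1r JD JZ !IH ?mulr0 ?addr0//.
    by rewrite (leq_trans (ltnW p'k)).
have : J (q * p)^`() = 0 by rewrite J_deriv !hornerM q1 q0 !mul0r subrr.
rewrite derivM q' -scalerAl JD Jq addr0 JZ => /eqP; rewrite mulf_eq0.
by rewrite addn2 (negbTE (natr_neq0 _)) => /eqP.
Qed.

Lemma legendre_poly_orthogonal j k : j != k ->
  J (legendre_poly j * legendre_poly k) = 0.
Proof.
rewrite neq_ltn => /orP[jk|kj]; first rewrite mulrC.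
all: apply: legendre_poly_orthogonal_low.
all: exact: leq_trans (size_legendre_poly _) _.
Qed.

(* Integrate ('X * P_k^2)' and use that 'X * P_k' - k P_k has degree < k. *)
Lemma legendre_poly_norm k :
  (2 * k + 1)%:R * J (legendre_poly k * legendre_poly k) = 1.
Proof.
set L := legendre_poly k.
have low : J (L * ('X * L^`() - k%:R *: L)) = 0.
  apply: legendre_poly_orthogonal_low; apply/leq_sizeP => i ki.
  rewrite coefB coefZ coefXM coef_deriv.
  case: i ki => [|i] ki /=.
    by move: ki; rewrite leqn0 => /eqP ->; rewrite mul0r subrr.
  have := ki; rewrite leq_eqVlt => /predU1P[->|ki'].
    by rewrite mulr_natl subrr.
  have -> : L`_i.+1 = 0.
    by apply/(leq_sizeP _ k.+1) => //; exact: size_legendre_poly.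
  by rewrite mulr0 mul0rn subrr.
have : J ('X * (L * L))^`() = 1.
  by rewrite J_deriv !hornerM !hornerX legendre_poly1; ring.
have -> : ('X * (L * L))^`() =
    (2 * k + 1)%:R *: (L * L) + 2 *: (L * ('X * L^`() - k%:R *: L)).
  rewrite !derivM derivX -![_ *: _]mul_polyC !rmorph_nat natrD natrM.
  by ring.
by rewrite JD !JZ low mulr0 addr0.
Qed.

End Orthogonality.
End LegendrePolynomials.

(** * Quadratic forms and Bessel's inequality *)

Section QuadraticForms.
Variable R : realType.

Lemma qformE n (M : 'M[R]_n) (v : 'cV[R]_n) :
  qform M v = \sum_a \sum_b v a 0 * M a b * v b 0.
Proof.
rewrite /qform -mulmxA mxE; apply: eq_bigr => a _; rewrite !mxE mulr_sumr.
by apply: eq_bigr => b _; rewrite mulrA.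
Qed.

Lemma bilin_sym n (M : 'M[R]_n) (v w : 'cV[R]_n) : M^T = M ->
  (v^T *m M *m w) 0 0 = (w^T *m M *m v) 0 0.
Proof.
move=> MT; rewrite -[in RHS]MT -[in RHS](trmxK v) -!trmx_mul mulmxA.
by rewrite [in RHS]mxE.
Qed.

Lemma qformD n (M : 'M[R]_n) (v w : 'cV[R]_n) : M^T = M ->
  qform M (v + w) = qform M v + 2 * (v^T *m M *m w) 0 0 + qform M w.
Proof.
move=> MT; rewrite /qform [(v + w)^T]linearD/= mulmxDl mulmxDr !mulmxDl.
rewrite mxE [X in X + _]mxE [X in _ + X]mxE.
by rewrite (bilin_sym w v MT); ring.
Qed.

Lemma qformZ n (M : 'M[R]_n) (c : R) (v : 'cV[R]_n) :
  qform M (c *: v) = c ^+ 2 * qform M v.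
Proof. by rewrite /qform [(_ *: _)^T]linearZ/= -!scalemxAl -scalemxAr scalerA mxE expr2. Qed.

End QuadraticForms.

Section BesselLegendre.
Variable R : realType.
Local Notation mu := (@lebesgue_measure R).
Local Notation lbm := (@locally_bounded_measurable R).

Lemma lbmZ (c : R) (w : R -> R) : lbm w -> lbm (fun s => c * w s).
Proof. by move=> lw; apply: lbmM => //; exact: lbm_cst. Qed.

Lemma lbm_qform n (M : 'M[R]_n) (r : R -> 'cV[R]_n) :
  (forall a, lbm (fun s => r s a 0)) -> lbm (fun s => qform M (r s)).
Proof.
move=> lr; under eq_fun do rewrite qformE.
apply: lbm_sum => a; apply: lbm_sum => b; apply: lbmM => //.
by apply: lbmM => //; exact: lbm_cst.
Qed.

Lemma lbm_mulmx n (u : 'rV[R]_n) (r : R -> 'cV[R]_n) :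
  (forall a, lbm (fun s => r s a 0)) -> lbm (fun s => (u *m r s) 0 0).
Proof.
move=> lr; under eq_fun do rewrite mxE.
by apply: lbm_sum => a; exact: lbmZ.
Qed.

Lemma Rintegral_lbmD (f g : R -> R) a b : lbm f -> lbm g ->
  \int[mu]_(s in `[a, b]) (f s + g s) =
  \int[mu]_(s in `[a, b]) f s + \int[mu]_(s in `[a, b]) g s.
Proof. by move=> lf lg; rewrite RintegralD//; exact: lbm_integrable. Qed.

Lemma Rintegral_lbmZ c (f : R -> R) a b : lbm f ->
  \int[mu]_(s in `[a, b]) (c * f s) = c * \int[mu]_(s in `[a, b]) f s.
Proof. by move=> lf; rewrite RintegralZl//; exact: lbm_integrable. Qed.

Lemma Rintegral_lbm_sum I (l : seq I) (F : I -> R -> R) a b :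
  (forall i, lbm (F i)) ->
  \int[mu]_(s in `[a, b]) (\sum_(i <- l) F i s) =
  \sum_(i <- l) \int[mu]_(s in `[a, b]) F i s.
Proof.
move=> lF; elim: l => [|i l IH].
  under eq_Rintegral do rewrite big_nil.
  by rewrite big_nil Rintegral_cst// mul0r.
under eq_Rintegral do rewrite big_cons.
by rewrite big_cons Rintegral_lbmD ?IH//; exact: lbm_sum.
Qed.

Lemma Rintegral_mulmx n (u : 'rV[R]_n) (L : R -> R) (r : R -> 'cV[R]_n) a b :
  lbm L -> (forall c, lbm (fun s => r s c 0)) ->
  \int[mu]_(s in `[a, b]) (L s * (u *m r s) 0 0) =
  (u *m \col_c \int[mu]_(s in `[a, b]) (L s * r s c 0)) 0 0.
Proof.
move=> lL lr; rewrite mxE.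
transitivity (\int[mu]_(s in `[a, b]) (\sum_c u 0 c * (L s * r s c 0))).
  apply: eq_Rintegral => s _; rewrite mxE mulr_sumr; apply: eq_bigr => c _.
  by rewrite mulrCA.
rewrite Rintegral_lbm_sum => [|c]; last by apply: lbmZ; exact: lbmM.
apply: eq_bigr => c _; rewrite Rintegral_lbmZ; last exact: lbmM.
by rewrite mxE.
Qed.

Variables (tau : R) (tau_gt0 : 0 < tau).

Definition affine01 : {poly R} := tau^-1 *: 'X + 1.

Definition slegendre k : {poly R} := legendre_poly R k \Po affine01.

Lemma horner_affine01 s : affine01.[s] = (s + tau) / tau.
Proof. by rewrite /affine01 !hornerE mulrDl divff ?gt_eqF// mulrC. Qed.

Lemma horner_slegendre k s :
  (slegendre k).[s] = (legendre_poly R k).[(s + tau) / tau].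
Proof. by rewrite horner_comp horner_affine01. Qed.

Lemma slegendre0 k : (slegendre k).[0] = 1.
Proof.
by rewrite horner_slegendre add0r divff ?gt_eqF// legendre_poly1.
Qed.

Lemma slegendreN k : (slegendre k).[- tau] = (-1) ^+ k.
Proof. by rewrite horner_slegendre addNr mul0r legendre_poly0. Qed.

Lemma deriv_slegendre N k : (k <= N)%N ->
  (slegendre k)^`() = - \sum_(j < N) (gammac R k j / tau) *: slegendre j.
Proof.
move=> kN; rewrite /slegendre deriv_comp (deriv_legendre_poly_gamma _ kN).
have -> : affine01^`() = (tau^-1)%:P.
  by rewrite /affine01 derivD derivZ derivX derivC addr0 alg_polyC.
rewrite mulrC mul_polyC raddfN/= scalerN; congr (- _).
rewrite raddf_sum scaler_sumr/=; apply: eq_bigr => j _.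
by rewrite comp_polyZ scalerA mulrC.
Qed.

(** After the substitution [affine01], the factor tau^-1 makes this the integral of p over
    [0, 1]. *)
Let J (p : {poly R}) : R :=
  tau^-1 * \int[mu]_(s in `[- tau, 0]) (p \Po affine01).[s].

Let JD p q : J (p + q) = J p + J q.
Proof.
rewrite /J -mulrDr -Rintegral_lbmD; [|exact: lbm_poly..].
congr (_ * _); apply: eq_Rintegral => s _.
by rewrite comp_polyD hornerD.
Qed.

Let JZ c p : J (c *: p) = c * J p.
Proof.
rewrite /J mulrCA -(Rintegral_lbmZ c); last exact: lbm_poly.
congr (_ * _); apply: eq_Rintegral => s _.
by rewrite comp_polyZ hornerZ.
Qed.

Let J_deriv p : J p^`() = p.[1] - p.[0].
Proof.
have t0 : - tau <= 0 by rewrite oppr_le0 ltW.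
have /(_ _ _ t0) := @derive_FTC R (horner (p \Po affine01))
  (horner (p \Po affine01)^`()).
move=> /(_ (@continuous_horner _ _) (fun t => is_derive_poly _ t)).
rewrite deriv_comp.
have -> : affine01^`() = (tau^-1)%:P.
  by rewrite /affine01 derivD derivZ derivX derivC addr0 alg_polyC.
rewrite mulrC mul_polyC !horner_comp !horner_affine01 add0r divff ?gt_eqF//.
rewrite addNr mul0r => ->.
rewrite /J -Rintegral_lbmZ; last exact: lbm_poly.
by apply: eq_Rintegral => s _; rewrite hornerZ.
Qed.

Let Jslegendre j k : \int[mu]_(s in `[- tau, 0]) ((slegendre j).[s] * (slegendre k).[s]) =
  tau * J (legendre_poly R j * legendre_poly R k).
Proof.
rewrite /J mulrA mulfV ?gt_eqF// mul1r; apply: eq_Rintegral => s _.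
by rewrite comp_polyM hornerM.
Qed.

Lemma slegendre_orthogonal j k : j != k ->
  \int[mu]_(s in `[- tau, 0]) ((slegendre j).[s] * (slegendre k).[s]) = 0.
Proof.
by move=> jk; rewrite Jslegendre (legendre_poly_orthogonal JD JZ J_deriv jk) mulr0.
Qed.

Lemma slegendre_norm k : (2 * k + 1)%:R *
  \int[mu]_(s in `[- tau, 0]) ((slegendre k).[s] * (slegendre k).[s]) = tau.
Proof.
by rewrite Jslegendre mulrCA (legendre_poly_norm JD JZ J_deriv) mulr1.
Qed.

Variables (n : nat) (M : 'M[R]_n) (w : R -> 'cV[R]_n).
Hypotheses (M_psd : psd M) (lw : forall a, lbm (fun s => w s a 0)).

Let c k := \col_a \int[mu]_(s in `[- tau, 0]) ((slegendre k).[s] * w s a 0).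

(** The Legendre coefficient of [w]: the squared norm of [slegendre k] is tau / (2k + 1). *)
Let d k := ((2 * k + 1)%:R / tau) *: c k.

Let r K s := w s - \sum_(k < K) (slegendre k).[s] *: d k.

Let lr K a : lbm (fun s => r K s a 0).
Proof.
have -> : (fun s => r K s a 0) =
    (fun s => w s a 0 - \sum_(k < K) (slegendre k).[s] * d k a 0).
  apply/funext => s; rewrite /r !mxE summxE; congr (_ - _).
  by apply: eq_bigr => k _; rewrite mxE.
apply: lbmB => //; apply: lbm_sum => k; apply: lbmM; last exact: lbm_cst.
exact: lbm_poly.
Qed.

(** By orthogonality, removing the components below K leaves the K-th moment unchanged. *)
Let c_r K : \col_a \int[mu]_(s in `[- tau, 0]) ((slegendre K).[s] * r K s a 0)
  = c K.
Proof.
apply/colP => a; rewrite !mxE.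
transitivity (\int[mu]_(s in `[- tau, 0])
  ((slegendre K).[s] * w s a 0
   + \sum_(k < K) (- d k a 0) * ((slegendre k).[s] * (slegendre K).[s]))).
  apply: eq_Rintegral => s _; rewrite /r !mxE summxE mulrBr; congr (_ + _).
  rewrite mulr_sumr -sumrN; apply: eq_bigr => k _; rewrite mxE; ring.
have lLL k : lbm (fun s => (slegendre k).[s] * (slegendre K).[s]).
  by apply: lbmM; exact: lbm_poly.
rewrite Rintegral_lbmD; last 2 first.
- by apply: lbmM => //; exact: lbm_poly.
- by apply: lbm_sum => k; exact: lbmZ.
rewrite Rintegral_lbm_sum => [|k]; last exact: lbmZ.
rewrite big1 ?addr0// => k _.
by rewrite Rintegral_lbmZ// slegendre_orthogonal ?mulr0// neq_ltn ltn_ord.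
Qed.

(** With A = (2K + 1) / tau and d = A c, the cross term contributes -2 A c^T M c and the square A
    c^T M c, since A times the squared norm of [slegendre K] is 1. *)
Let r_step K : \int[mu]_(s in `[- tau, 0]) qform M (r K.+1 s) =
  \int[mu]_(s in `[- tau, 0]) qform M (r K s)
  - (2 * K + 1)%:R / tau * qform M (c K).
Proof.
have [MT _] := M_psd.
have lL := lbm_poly (slegendre K).
have lLL : lbm (fun s => (slegendre K).[s] * (slegendre K).[s]) by exact: lbmM.
transitivity (\int[mu]_(s in `[- tau, 0]) (qform M (r K s)
   + ((-2) * ((slegendre K).[s] * ((d K)^T *m M *m r K s) 0 0)
      + qform M (d K) * ((slegendre K).[s] * (slegendre K).[s])))).
  apply: eq_Rintegral => s _.
  have -> : r K.+1 s = r K s + (- (slegendre K).[s]) *: d K.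
    by rewrite /r big_ord_recr/= opprD addrA scaleNr.
  rewrite qformD// qformZ -scalemxAr mxE (bilin_sym (r K s))//.
  by ring.
have lm : lbm (fun s => (slegendre K).[s] * ((d K)^T *m M *m r K s) 0 0).
  by apply: lbmM => //; exact: lbm_mulmx.
rewrite Rintegral_lbmD; [|exact: lbm_qform|by apply: lbmD; exact: lbmZ].
congr (_ + _); rewrite Rintegral_lbmD ?Rintegral_lbmZ//; [|exact: lbmZ..].
rewrite Rintegral_mulmx// c_r.
set A := (2 * K + 1)%:R / tau.
have -> : ((d K)^T *m M *m c K) 0 0 = A * qform M (c K).
  by rewrite /d linearZ/= -!scalemxAl mxE.
have -> : qform M (d K) = A ^+ 2 * qform M (c K) by rewrite qformZ.
have := slegendre_norm K; set I := Rintegral _ _ _ => HI.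
have AI : A * I = 1 by rewrite /A mulrAC HI divff// gt_eqF.
have -> : A ^+ 2 * qform M (c K) * I = A * I * (A * qform M (c K)) by ring.
by rewrite AI; ring.
Qed.

(** The energy of the residual is computed exactly by telescoping [r_step], and it is nonnegative
    because M is positive semidefinite. *)
Lemma bessel_legendre K :
  \sum_(k < K) (2 * k + 1)%:R * qform M (c k) <=
  tau * \int[mu]_(s in `[- tau, 0]) qform M (w s).
Proof.
have rE : \int[mu]_(s in `[- tau, 0]) qform M (r K s) =
    \int[mu]_(s in `[- tau, 0]) qform M (w s)
    - tau^-1 * \sum_(k < K) (2 * k + 1)%:R * qform M (c k).
  elim: K => [|K IH].
    rewrite big_ord0 mulr0 subr0; apply: eq_Rintegral => s _.
    by rewrite /r big_ord0 subr0.
  by rewrite r_step IH big_ord_recr/=; ring.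
have : 0 <= \int[mu]_(s in `[- tau, 0]) qform M (r K s).
  by apply: Rintegral_ge0 => s _; exact: M_psd.2.
by rewrite rE subr_ge0 mulrC ler_pdivrMr// mulrC.
Qed.

End BesselLegendre.

(** * The matrix inequality *)

Section DissipationInequality.
Variable R : realType.

Let mx11D (A B : 'M[R]_1) : (A + B) 0 0 = A 0 0 + B 0 0. Proof. by rewrite mxE. Qed.
Let mx11N (A : 'M[R]_1) : (- A) 0 0 = - A 0 0. Proof. by rewrite mxE. Qed.
Let mx11Z (c : R) (A : 'M[R]_1) : (c *: A) 0 0 = c * A 0 0. Proof. by rewrite mxE. Qed.
Let mx11_sum I (r : seq I) (A : I -> 'M[R]_1) :
  (\sum_(i <- r) A i) 0 0 = \sum_(i <- r) A i 0 0.
Proof. by rewrite summxE. Qed.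

Lemma qform_block n m (A : 'M[R]_n) (B : 'M[R]_(n, m)) (D : 'M[R]_m)
    (x : 'cV[R]_n) (u : 'cV[R]_m) :
  qform (block_mx A B B^T D) (col_mx x u) =
  qform A x + 2 * (x^T *m B *m u) 0 0 + qform D u.
Proof.
rewrite /qform -mulmxA mul_block_col tr_col_mx mul_row_col !mulmxDr !mx11D.
have -> : (u^T *m (B^T *m x)) 0 0 = (x^T *m B *m u) 0 0.
  by rewrite -[x in LHS]trmxK -!trmx_mul mxE.
by rewrite !mulmxA; ring.
Qed.

Lemma qform_mxdiag q (p : 'I_q -> nat) (D : forall i, 'M[R]_(p i))
    (C : forall i, 'cV[R]_(p i)) :
  qform (\mxdiag_i D i) (\mxcol_i C i) = \sum_i qform (D i) (C i).
Proof.
rewrite /qform -mulmxA mul_mxdiag_mxcol tr_mxcol mul_mxrow_mxcol mx11_sum.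
by apply: eq_bigr => i _; rewrite mulmxA.
Qed.

Lemma qform_sym n (A : 'M[R]_n) (v : 'cV[R]_n) : qform (sym A) v = qform A v.
Proof.
rewrite /qform /sym -scalemxAr -scalemxAl mulmxDr mulmxDl mx11Z mx11D.
have -> : (v^T *m A^T *m v) 0 0 = (v^T *m A *m v) 0 0.
  transitivity ((v^T *m A *m v)^T 0 0); last by rewrite mxE.
  by rewrite !trmx_mul trmxK mulmxA.
by field.
Qed.

Section Zeta.
Variables (n q N : nat) (tau : 'I_q -> R) (Rm : 'I_q -> 'M[R]_n).
Variables (x0 : 'cV[R]_n) (xd : 'I_q -> 'cV[R]_n) (w : 'I_q -> 'I_N -> 'cV[R]_n).

Definition Gamma_zeta (i : 'I_q) (k : nat) : 'cV[R]_n :=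
  x0 + (-1) ^+ k.+1 *: xd i + \sum_(l < N) gammac R k l *: w i l.

Lemma Gamma_rowE i k : Gamma_row R n N i k *m zeta x0 xd w = Gamma_zeta i k.
Proof.
rewrite /Gamma_row /zeta !mul_row_col mul1mx !mul_mxrow_mxcol /Gamma_zeta.
congr (_ + _ + _).
  rewrite (bigD1 i)//= eqxx mul_scalar_mx big1 ?addr0// => j /negbTE ->.
  by rewrite mul0mx.
under eq_bigr do rewrite mul_mxrow_mxcol.
rewrite (bigD1 i)//= [X in _ + X]big1 ?addr0 => [|j ji].
  by apply: eq_bigr => l _; rewrite eqxx mul_scalar_mx.
by rewrite big1// => l _; rewrite (negbTE ji) mul0mx.
Qed.

Lemma G_mxE : G_mx n N tau *m zeta x0 xd w =
  \mxcol_(i < q) \mxcol_(k < N) (tau i *: w i k).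
Proof.
rewrite /G_mx /zeta mul_row_col mul0mx add0r mul_mxdiag_mxcol.
apply: eq_mxcol => i; rewrite mul_scalar_mx.
by apply/colP => a; rewrite !mxE.
Qed.

Lemma H_mxE : H_mx R n q N *m zeta x0 xd w =
  \mxcol_(i < q) \mxcol_(k < N) Gamma_zeta i k.
Proof.
rewrite /H_mx mxcol_mul; apply: eq_mxcol => i; rewrite mxcol_mul.
by apply: eq_mxcol => k; rewrite Gamma_rowE.
Qed.

Lemma Gamma_mxE :
  qform ((Gamma_mx R n q N)^T *m R_mx N Rm *m Gamma_mx R n q N) (zeta x0 xd w) =
  \sum_(i < q) \sum_(k < N.+1) (2 * k + 1)%:R * qform (Rm i) (Gamma_zeta i k).
Proof.
set z := zeta _ _ _; set Gm := Gamma_mx _ _ _ _.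
have -> : qform (Gm^T *m R_mx N Rm *m Gm) z = qform (R_mx N Rm) (Gm *m z).
  by rewrite /qform trmx_mul !mulmxA.
rewrite /Gm /Gamma_mx mxcol_mul qform_mxdiag; apply: eq_bigr => i _.
rewrite /Gamma_blk mxcol_mul qform_mxdiag; apply: eq_bigr => k _.
by rewrite Gamma_rowE /qform -scalemxAr -scalemxAl mx11Z.
Qed.

End Zeta.

(** The velocity is affine in u, so each term is a quadratic form in (1, u): its constant part lies
    in [Psi_xx], its linear part in [Psi_xu], which the block form doubles, and its quadratic part
    in [Psi_uu]. The blocks of the supply move to the right-hand side. *)
Lemma dissipation_ineq (n m q N : nat) (tau : 'I_q -> R)
    (f : 'cV[R]_(n + \sum_(i < q) n) -> 'cV[R]_n)
    (g : 'cV[R]_n -> 'M[R]_(n, m)) (h : 'cV[R]_n -> 'cV[R]_m)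
    (S11 S12 S22 : 'M[R]_m) (S1 : 'cV[R]_n -> R)
    (P : 'M[R]_(\sum_(i < q) \sum_(k < N) n))
    (Theta : 'I_q -> 'cV[R]_n -> R) (Rm : 'I_q -> 'M[R]_n)
    (x0 : 'cV[R]_n) (xd : 'I_q -> 'cV[R]_n) (w : 'I_q -> 'I_N -> 'cV[R]_n)
    (u : 'cV[R]_m) :
  psd P -> (forall i, psd (Rm i)) ->
  nsd (Psi_mx tau f g h S11 S12 S22 S1 P Theta Rm x0 xd w) ->
  let v := f (col_mx x0 (\mxcol_(i < q) xd i)) + g x0 *m u in
  ((gradient S1 x0)^T *m v) 0 0
  + 2 * ((\mxcol_(i < q) \mxcol_(k < N) (tau i *: w i k))^T *m P
         *m (\mxcol_(i < q) \mxcol_(k < N) Gamma_zeta x0 xd w i k)) 0 0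
  + \sum_i (Theta i x0 - Theta i (xd i))
  + \sum_i (tau i ^+ 2 * qform (Rm i) v
            - \sum_(k < N.+1) (2 * k + 1)%:R * qform (Rm i) (Gamma_zeta x0 xd w i k))
  <= quadratic_supply S11 S12 S22 (h x0) u.
Proof.
move=> [PT _] Rpsd [_ /(_ (col_mx 1 u))].
set F := f _; set z := zeta x0 xd w.
rewrite /Psi_mx qform_block /quadratic_supply qform_block.
have -> : qform (Psi_xx tau f h S11 S1 P Theta Rm x0 xd w) 1 =
    ((gradient S1 x0)^T *m F) 0 0
    + 2 * ((\mxcol_(i < q) \mxcol_(k < N) (tau i *: w i k))^T *m P
         *m (\mxcol_(i < q) \mxcol_(k < N) Gamma_zeta x0 xd w i k)) 0 0
    + \sum_i tau i ^+ 2 * qform (Rm i) F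
    + \sum_i (Theta i x0 - Theta i (xd i))
    - \sum_(i < q) \sum_(k < N.+1) (2 * k + 1)%:R
        * qform (Rm i) (Gamma_zeta x0 xd w i k)
    - qform S11 (h x0).
  rewrite -(G_mxE tau x0 xd w) -(H_mxE x0 xd w) -Gamma_mxE sumrB -/z.
  rewrite {1}/qform trmx1 mul1mx mulmx1 /Psi_xx -/F -/z.
  rewrite !(mx11D, mx11N, mx11Z) mx11_sum.
  have -> : (z^T *m sym ((G_mx n N tau)^T *m P *m H_mx R n q N) *m z) 0 0 =
      ((G_mx n N tau *m z)^T *m P *m (H_mx R n q N *m z)) 0 0.
    by rewrite -/(qform _ _) qform_sym /qform trmx_mul !mulmxA.
  have -> : \sum_i (tau i ^+ 2 *: (F^T *m Rm i *m F)) 0 0 =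
      \sum_i tau i ^+ 2 * qform (Rm i) F.
    by apply: eq_bigr => i _; rewrite mx11Z.
  have -> (c : R) : (c%:M : 'M[R]_1) 0 0 = c by rewrite mxE eqxx mulr1n.
  have -> (c : R) : (c%:M : 'M[R]_1) 0 0 = c by rewrite mxE eqxx mulr1n.
  by rewrite /qform !mulmxA; ring.
have -> : ((1 : 'cV[R]_1)^T *m Psi_xu tau f g h S12 S1 Rm x0 xd *m u) 0 0 =
    2^-1 * ((gradient S1 x0)^T *m (g x0 *m u)) 0 0
    + \sum_i tau i ^+ 2 * (F^T *m Rm i *m (g x0 *m u)) 0 0
    - ((h x0)^T *m S12 *m u) 0 0.
  rewrite trmx1 mul1mx /Psi_xu -/F !(mulmxDl, mulNmx) !(mx11D, mx11N).
  rewrite mulmx_suml mx11_sum -scalemxAl mx11Z mulmxA.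
  congr (_ + _ - _); apply: eq_bigr => i _.
  by rewrite -scalemxAl mx11Z !mulmxA.
have -> : qform (Psi_uu tau g S22 Rm x0) u =
    \sum_i tau i ^+ 2 * qform (Rm i) (g x0 *m u) - qform S22 u.
  rewrite {1}/qform /Psi_uu mulmxBr mulmxBl mx11D mx11N; congr (_ - _).
  rewrite mulmx_sumr mulmx_suml mx11_sum; apply: eq_bigr => i _.
  by rewrite -scalemxAr -scalemxAl mx11Z /qform trmx_mul !mulmxA.
move=> LMI; set v := F + g x0 *m u; rewrite [X in _ + X <= _]sumrB.
have -> : \sum_i tau i ^+ 2 * qform (Rm i) v =
    \sum_i tau i ^+ 2 * qform (Rm i) F
    + 2 * \sum_i tau i ^+ 2 * (F^T *m Rm i *m (g x0 *m u)) 0 0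
    + \sum_i tau i ^+ 2 * qform (Rm i) (g x0 *m u).
  rewrite mulr_sumr -!big_split/=; apply: eq_bigr => i _.
  by rewrite /v qformD ?(Rpsd i).1//; ring.
rewrite /v mulmxDr mx11D; move: LMI; lra.
Qed.

End DissipationInequality.

(** * Calculus along curves *)

Section MatrixNorm.
Variable R : realType.

Lemma le_mx_coord m n (A : 'M[R]_(m, n)) i j : `|A i j| <= `|A|.
Proof.
rewrite [X in _ <= X]mx_normrE.
exact: (le_bigmax _ (fun ij : 'I_m * 'I_n => `|A ij.1 ij.2|) (i, j)).
Qed.

Lemma mx_norm_le_bound m n (A : 'M[R]_(m, n)) (K : R) : 0 <= K ->
  (forall i j, `|A i j| <= K) -> `|A| <= K.
Proof.
move=> K0 AK; rewrite [X in X <= _]mx_normrE.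
by apply: bigmax_le => // ij _; exact: AK.
Qed.

Lemma mx_continuousP (T : topologicalType) m n (y : T -> 'M[R]_(m, n)) :
  (forall i j, continuous (fun t => y t i j)) -> continuous y.
Proof.
move=> cy t; apply/cvgrPdist_lt => e e0.
have e20 : 0 < e / 2 by rewrite divr_gt0.
have : \forall s \near t, forall ij : 'I_m * 'I_n,
    `|y t ij.1 ij.2 - y s ij.1 ij.2| <= e / 2.
  apply: filter_forall => ij.
  by have /cvgrPdist_le := cy ij.1 ij.2 t; apply.
apply: filterS => s ys; apply: (@le_lt_trans _ _ (e / 2)); last first.
  by rewrite ltr_pdivrMr// ltr_pMr// ltr1n.
apply: mx_norm_le_bound => [|i j]; first exact: ltW.
by rewrite !mxE; exact: (ys (i, j)).
Qed.

Lemma continuous_coord (T : topologicalType) m n (y : T -> 'M[R]_(m, n)) i j :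
  continuous y -> continuous (fun t => y t i j).
Proof.
move=> cy t; apply: (@continuous_comp _ _ _ y (fun A : 'M[R]_(m, n) => A i j)).
  exact: cy.
exact: coord_continuous.
Qed.

Lemma locally_lipschitz_continuous (V W : normedModType R) (F : V -> W) :
  locally_lipschitz F -> continuous F.
Proof.
move=> lF x.
have := lF (x, x) (conj Logic.I Logic.I).
rewrite /lipschitz_on => -[M [_ HM]].
(* The local bound holds for every constant above M; this one is also positive, so it can be divided
   by. *)
pose K := Num.max M 0 + 1.
have K0 : 0 < K by rewrite /K ltr_wpDl// le_max lexx orbT.
have /HM : M < K by rewrite /K ltr_pwDr// le_max lexx.
rewrite /dominated_by /= => -[[A B] [/= Ax Bx] AB].
apply/cvgrPdist_lt => e e0; near=> z.
have {}xz : `|F x - F z| <= K * `|x - z|.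
  apply: (AB (x, z)) => //; split => /=; first exact: nbhs_singleton.
  by near: z.
apply: (le_lt_trans xz); rewrite mulrC -ltr_pdivlMr//; near: z.
by have /cvgrPdist_lt := @cvg_id _ (nbhs x); apply; rewrite divr_gt0.
Unshelve. all: by end_near. Qed.

End MatrixNorm.

Section Calculus.
Variable R : realType.
Local Notation mu := (@lebesgue_measure R).
Local Notation lbm := (@locally_bounded_measurable R).

Lemma is_derive_bigsum (V : normedModType R) I (l : seq I) (F : I -> R -> V)
    (dF : I -> V) (t : R) :
  (forall i, is_derive t 1 (F i) (dF i)) ->
  is_derive t 1 (fun t => \sum_(i <- l) F i t) (\sum_(i <- l) dF i).
Proof.
move=> dFi; elim: l => [|i l IH].
  under eq_fun do rewrite big_nil; rewrite big_nil; exact: is_derive_cst.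
under eq_fun do rewrite big_cons; rewrite big_cons; exact: is_deriveD.
Qed.

Lemma is_derive_coord m n (y : R -> 'M[R]_(m, n)) (t : R) (dy : 'M[R]_(m, n)) i j :
  is_derive t 1 y dy -> is_derive t 1 (fun t => y t i j) (dy i j).
Proof.
move=> [y1 <-]; rewrite derive_mx// mxE; apply/derivableP.
exact: (derivable_mxP y t 1).1.
Qed.

Lemma is_derive_qform n (M : 'M[R]_n) (y : R -> 'cV[R]_n) (t : R) (dy : 'cV[R]_n) :
  M^T = M -> (forall a, is_derive t 1 (fun t => y t a 0) (dy a 0)) ->
  is_derive t 1 (fun t => qform M (y t)) (2 * ((y t)^T *m M *m dy) 0 0).
Proof.
move=> MT ydy; under eq_fun do rewrite qformE.
have -> : 2 * ((y t)^T *m M *m dy) 0 0 =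
    \sum_a \sum_b (y t a 0 * M a b * dy b 0 + dy a 0 * M a b * y t b 0).
  rewrite mulr_natl mulr2n {2}(bilin_sym _ _ MT) -!mulmxA.
  rewrite !mxE -big_split/=; apply: eq_bigr => a _.
  rewrite !mxE !mulr_sumr -big_split/=; apply: eq_bigr => b _.
  by rewrite !mulrA.
apply: is_derive_bigsum => a; apply: is_derive_bigsum => b.
have := is_deriveM (is_deriveM (ydy a) (is_derive_cst (M a b) t 1)) (ydy b).
move=> H; apply: (is_derive_eq H).
rewrite /= scaler0 add0r.
rewrite -![_ *: _]/(_ * _) /cst; congr (_ + _).
by rewrite mulrC [M a b * _]mulrC.
Qed.

Lemma gradientE n (V : 'cV[R]_n -> R) (x v : 'cV[R]_n) : differentiable V x ->
  'd V x v = ((gradient V x)^T *m v) 0 0.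
Proof.
move=> dV; have {1}-> : v = \sum_a v a 0 *: delta_mx a 0.
  apply/colP => a; rewrite summxE (bigD1 a)//= big1 => [|b ba].
    by rewrite !mxE !eqxx mulr1 addr0.
  by rewrite !mxE eq_sym (negbTE ba) mulr0.
rewrite linear_sum mxE; apply: eq_bigr => a _.
by rewrite linearZ/= !mxE deriveE// mulrC.
Qed.

Lemma is_derive_chain n (V : 'cV[R]_n -> R) (y : R -> 'cV[R]_n) (t : R) (dy : 'cV[R]_n) :
  differentiable V (y t) -> is_derive t 1 y dy ->
  is_derive t 1 (V \o y) (((gradient V (y t))^T *m dy) 0 0).
Proof.
move=> dV [y1 yE].
have dy' : differentiable y t by exact/derivable1_diffP.
have dVy : differentiable (V \o y) t by exact: differentiable_comp.
apply: DeriveDef; first exact/derivable1_diffP.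
by rewrite deriveE// diff_comp//= -gradientE// -yE deriveE.
Qed.

(** For the max norm, the sum of the absolute partial derivatives bounds the differential; the 1
    absorbs the little-o remainder. *)
Lemma gradient_local_lipschitz n (V : 'cV[R]_n -> R) (x : 'cV[R]_n) :
  differentiable V x ->
  \forall z \near x, `|V z - V x| <= (\sum_a `|gradient V x a 0| + 1) * `|z - x|.
Proof.
move=> dV; have /eqaddoP /(_ 1 ltr01) := diff_locally dV.
move=> H.
rewrite (nbhs0P (fun z => `|V z - V x| <= (\sum_a `|gradient V x a 0| + 1) * `|z - x|)).
apply: filterS H => h; rewrite /= !fctE mul1r [h + x]addrC => H.
rewrite [x + h - x]addrC addKr mulrDl mul1r.
have -> : V (x + h) - V x = 'd V x h + (V (x + h) - (V x + 'd V x h)) by ring.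
apply: le_trans (ler_normD _ _) _; apply: lerD => //.
rewrite gradientE// mxE mulr_suml; apply: le_trans (ler_norm_sum _ _ _) _.
apply: ler_sum => a _; rewrite normrM mxE ler_wpM2l//.
exact: le_mx_coord.
Qed.

End Calculus.

(** * Lipschitz functions on an interval, with the constant left implicit *)

Section LipschitzOn.
Variable R : realType.
Local Notation mu := (@lebesgue_measure R).
Local Notation lbm := (@locally_bounded_measurable R).
Implicit Types (F G : R -> R) (a b : R).

Definition lipschitz_itv a b F : Prop := exists K : R,
  forall s t, a <= s -> s <= t -> t <= b -> `|F t - F s| <= K * (t - s).

Lemma lipschitz_itvD a b F G : lipschitz_itv a b F -> lipschitz_itv a b G ->
  lipschitz_itv a b (fun t => F t + G t).
Proof.
move=> [K HK] [L HL]; exists (K + L) => s t as_ st tb.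
have -> : F t + G t - (F s + G s) = (F t - F s) + (G t - G s) by ring.
by apply: le_trans (ler_normD _ _) _; rewrite mulrDl lerD ?HK ?HL.
Qed.

Lemma lipschitz_itvZ a b c F : lipschitz_itv a b F ->
  lipschitz_itv a b (fun t => c * F t).
Proof.
move=> [K HK]; exists (`|c| * K) => s t as_ st tb.
by rewrite -mulrBr normrM -mulrA ler_wpM2l// HK.
Qed.

Lemma lipschitz_itv_sum a b I (l : seq I) (F : I -> R -> R) :
  (forall i, lipschitz_itv a b (F i)) ->
  lipschitz_itv a b (fun t => \sum_(i <- l) F i t).
Proof.
move=> HF; elim: l => [|i l IH].
  by exists 0 => s t _ _ _; rewrite !big_nil subrr normr0 mul0r.
by under eq_fun do rewrite big_cons; exact: lipschitz_itvD.
Qed.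

Lemma lipschitz_itv_derive a b F (dF : R -> R) : lbm dF ->
  (forall t : R, is_derive t 1 F (dF t)) -> lipschitz_itv a b F.
Proof.
move=> [_ /(_ a b)[K HK]] FdF; exists (K + 1).
exact: (@derive_lipschitz_on R R F dF).
Qed.

Lemma lipschitz_itv_primitive a b w : lbm w -> lipschitz_itv a b (primitive w).
Proof. by move=> /(primitive_lipschitz_on a b)[K _ HK]; exists K. Qed.

Lemma lipschitz_itv_continuous F : (forall a b, lipschitz_itv a b F) ->
  continuous F.
Proof.
move=> HF t; have [K HK] := HF (t - 1) (t + 1).
apply/cvgrPdist_lt => e e0; near=> s.
have K0 : 0 < `|K| + 1 by have := normr_ge0 K; lra.
have st1 : `|t - s| < 1.
  by near: s; have /cvgrPdist_lt := @cvg_id _ (nbhs t); exact.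
have ste : `|t - s| < e / (`|K| + 1).
  near: s; have /cvgrPdist_lt := @cvg_id _ (nbhs t); apply.
  by rewrite divr_gt0.
move: ste; rewrite ltr_pdivlMr//; apply: le_lt_trans.
apply: (@le_trans _ _ (`|K| * `|t - s|)); last first.
  by rewrite mulrC ler_wpM2l// lerDl.
move: st1; rewrite ltr_norml => /andP[s1 s2].
have [st|ts] := leP s t.
  rewrite [`|t - s|]ger0_norm ?subr_ge0//.
  apply: le_trans (HK s t _ st _) _; try lra.
  by rewrite ler_wpM2r ?subr_ge0// ler_norm.
rewrite (distrC (F t)) (distrC t) [`|s - t|]ger0_norm; last by lra.
apply: le_trans (HK t s _ (ltW ts) _) _; try lra.
by rewrite ler_wpM2r ?ler_norm//; lra.
Unshelve. all: by end_near. Qed.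

Lemma continuous_primitive w : lbm w -> continuous (primitive w).
Proof.
move=> lw; apply: lipschitz_itv_continuous => a b.
exact: lipschitz_itv_primitive.
Qed.

(** The gradient is bounded along the curve itself, over a compact time interval. The estimates hold
    near each time and [local_lipschitz_on] glues them, so no mean value inequality on a convex set
    of states is involved. *)
Lemma lipschitz_itv_C1_comp n (V : 'cV[R]_n -> R) (X : R -> 'cV[R]_n) a b (K : R) :
  C1_fun V -> continuous X ->
  (forall s t, a <= s -> s <= t -> t <= b -> `|X t - X s| <= K * (t - s)) ->
  lipschitz_itv a b (V \o X).
Proof.
move=> [dV cV] cX HK.
have lG : lbm (fun t => \sum_c `|gradient V (X t) c 0|).
  apply: lbm_sum => c; apply: lbm_continuous => t.
  apply: (@continuous_comp _ _ _ (fun t => gradient V (X t) c 0) (fun r : R => `|r|)).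
    apply: (@continuous_coord R _ _ _ (gradient V \o X)) => s.
    by apply: continuous_comp; [exact: cX|exact: cV].
  exact: norm_continuous.
have [G HG] := lG.2 a b.
exists ((G + 1) * K); apply: (@local_lipschitz_on R R) => c ac cb.
have /= := cX c.
move=> /(_ _ (gradient_local_lipschitz (dV (X c)))) /=.
move=> /nbhs_ballP[e /= e0 He]; exists e => // t at_ tb tce.
have {}He := He t _; apply: le_trans (He _) _.
  by rewrite /ball/= distrC.
rewrite -mulrA ler_pM//.
- by rewrite addr_ge0// sumr_ge0.
- by rewrite lerD2r (le_trans (ler_norm _))// HG.
have [tc|ct] := leP c t.
  by rewrite [`|t - c|]ger0_norm ?subr_ge0// HK.
rewrite (distrC (X t)) (distrC t) [`|c - t|]ger0_norm; last by lra.
by rewrite HK// ltW.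
Qed.

End LipschitzOn.

(** * The storage functional along a solution *)

Section AlmostEverywhere.
Variable R : realType.
Local Notation mu := (@lebesgue_measure R).

Lemma ae_neq (c : R) : {ae mu, forall s, s != c}.
Proof.
exists [set c]; split; [exact: measurable_set1|exact: lebesgue_measure_set1|].
by move=> s /= /negP; rewrite negbK => /eqP.
Qed.

Lemma ae_shift (c : R) (Q : R -> Prop) :
  {ae mu, forall s, Q s} -> {ae mu, forall s, Q (c + s)}.
Proof.
move=> [N [mN N0 QN]]; exists ((fun s => c + s) @^-1` N); split.
- have mc : measurable_fun setT
      (fun t : measurableTypeR R => (c + t : measurableTypeR R)).
    exact: measurable_funD.
  by rewrite -[X in measurable X]setTI; exact: mc.
- by rewrite lebesgue_measureDl.
- by move=> s /= Qs; exact: QN.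
Qed.

Lemma eq_ae_Rintegral (D : set R) (f g : R -> R) :
  {ae mu, forall x, D x -> f x = g x} ->
  \int[mu]_(x in D) f x = \int[mu]_(x in D) g x.
Proof.
move=> fg; rewrite /Rintegral; congr fine; apply: eq_ae_integral.
move: fg; apply: filterS; first exact: (ae_filter_ringOfSetsType mu).
by move=> x H Dx; rewrite H.
Qed.

End AlmostEverywhere.

Section StorageForm.
Variables (R : realType) (n q N : nat) (tau : 'I_q -> R) (A : R).
Hypotheses (tau_gt0 : forall i, 0 < tau i) (tau_le : forall i, tau i <= A).
Local Notation mu := (@lebesgue_measure R).

(** The two-sided derivatives at - A and 0 see values outside the window, but these two points are
    negligible under the integral; elsewhere the functions agree on a neighbourhood. *)
Lemma storage_form_eq (S1 : 'cV[R]_n -> R)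
    (P : 'M[R]_(\sum_(i < q) \sum_(k < N) n))
    (Theta : 'I_q -> 'cV[R]_n -> R) (Rm : 'I_q -> 'M[R]_n)
    (phi psi : R -> 'cV[R]_n) : 0 <= A ->
  {in `[- A, 0], phi =1 psi} ->
  storage_form tau S1 P Theta Rm phi = storage_form tau S1 P Theta Rm psi.
Proof.
move=> A0 E.
have inA i (s : R) : s \in `[- tau i, 0] -> s \in `[- A, 0].
  rewrite !in_itv/= => /andP[ts ->]; rewrite andbT (le_trans _ ts)//.
  by rewrite lerN2.
have inA' i (s : R) : s \in `[- tau i, 0]%classic -> s \in `[- A, 0].
  by rewrite inE; exact: inA.
have E1 : xhat N tau phi = xhat N tau psi.
  rewrite /xhat; apply: eq_mxcol => i; apply: eq_mxcol => k.
  apply/colP => a; rewrite !mxE; apply: eq_Rintegral => s /inA' sA.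
  by rewrite E.
have E2 i : \int[mu]_(s in `[- tau i, 0]) Theta i (phi s) =
    \int[mu]_(s in `[- tau i, 0]) Theta i (psi s).
  by apply: eq_Rintegral => s /inA' sA; rewrite E.
have E3 i : \int[mu]_(theta in `[- tau i, 0])
      \int[mu]_(s in `[theta, 0]) qform (Rm i) (derive1 phi s) =
    \int[mu]_(theta in `[- tau i, 0])
      \int[mu]_(s in `[theta, 0]) qform (Rm i) (derive1 psi s).
  apply: eq_Rintegral => theta /set_mem /= thA.
  apply: eq_ae_Rintegral.
  move: (ae_neq (0 : R)) (ae_neq (- A)).
  apply: filterS2; first exact: (ae_filter_ringOfSetsType mu).
  move=> s s0 sA /=; rewrite in_itv/= => /andP[ths s0'].
  have sI : s \in `]- A, 0[.
    rewrite in_itv/= !lt_neqAle s0' s0 eq_sym sA/= andbT.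
    move/(inA i): thA; rewrite in_itv/= => /andP[Ath _].
    exact: le_trans ths.
  suff -> : derive1 phi s = derive1 psi s by [].
  rewrite !derive1E; apply: near_eq_derive.
  have : \forall z \near s, z \in `]- A, 0[ by exact: near_in_itvoo.
  apply: filterS => z; rewrite in_itv/= => /andP[Az z0].
  by apply: E; rewrite in_itv/= !ltW.
have F2 : \sum_(i < q) \int[mu]_(s in `[- tau i, 0]) Theta i (phi s) =
    \sum_(i < q) \int[mu]_(s in `[- tau i, 0]) Theta i (psi s).
  by apply: eq_bigr => i _; exact: E2.
have F3 : \sum_(i < q) tau i * (\int[mu]_(theta in `[- tau i, 0])
      \int[mu]_(s in `[theta, 0]) qform (Rm i) (derive1 phi s)) =
    \sum_(i < q) tau i * (\int[mu]_(theta in `[- tau i, 0])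
      \int[mu]_(s in `[theta, 0]) qform (Rm i) (derive1 psi s)).
  by apply: eq_bigr => i _; exact: (congr1 ( *%R (tau i)) (E3 i)).
have F0 : phi 0 = psi 0 by apply: E; rewrite in_itv/= lexx oppr_le0 A0.
rewrite /storage_form F0 E1.
exact: (congr2 +%R (congr2 +%R (erefl _) F2) F3).
Qed.

End StorageForm.

Section StorageAlongSolution.
Variables (R : realType) (n q N : nat) (tau : 'I_q -> R) (A T : R).
Hypotheses (tau_gt0 : forall i, 0 < tau i) (tau_le : forall i, tau i <= A).
Variables (X v : R -> 'cV[R]_n) (K : R).
Hypotheses (cX : continuous X) (lv : forall a, locally_bounded_measurable (fun t => v t a 0)).
Hypothesis XK : forall s t, - A <= s -> s <= t -> t <= T ->
  `|X t - X s| <= K * (t - s).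
Hypothesis dX : {ae @lebesgue_measure R, forall t, t \in `]- A, T[ ->
  is_derive t 1 X (v t)}.
Local Notation mu := (@lebesgue_measure R).
Local Notation lbm := (@locally_bounded_measurable R).

Let cXa a : continuous (fun t => X t a 0).
Proof. exact: continuous_coord. Qed.

Let tauN_le0 i : - tau i <= 0.
Proof. by rewrite oppr_le0 ltW. Qed.

Lemma legendreE i k s : legendre tau i k s = (slegendre (tau i) k).[s].
Proof. by rewrite horner_slegendre// horner_legendre_poly. Qed.

Definition Omega_at i k t : 'cV[R]_n :=
  \col_a \int[mu]_(s in `[- tau i, 0]) ((slegendre (tau i) k).[s] * X (t + s) a 0).

Lemma Omega_segment i k t : Omega tau i k (segment X t) = Omega_at i k t.
Proof.
apply/colP => a; rewrite !mxE; apply: eq_Rintegral => s _.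
by rewrite legendreE.
Qed.

(** The derivative of the moment after integration by parts, with 1 and (-1)^k as the endpoint
    values of the polynomial. It needs X to be continuous only. *)
Definition dOmega i k t : 'cV[R]_n :=
  \col_a (X t a 0 - (-1) ^+ k * X (t - tau i) a 0
    - \int[mu]_(s in `[- tau i, 0]) ((slegendre (tau i) k)^`().[s] * X (t + s) a 0)).

Lemma is_derive_Omega i k a (t : R) :
  is_derive t 1 (fun t => Omega_at i k t a 0) (dOmega i k t a 0).
Proof.
under eq_fun do rewrite mxE.
have H := is_derive_poly_conv (slegendre (tau i) k) t (tauN_le0 i) (cXa (a := a)).
apply: (is_derive_eq H).
by rewrite mxE slegendre0// slegendreN// addr0 mul1r.
Qed.

(** The derivative of the k-th polynomial is a combination of those below N with coefficients -
    gamma / tau_i, and this tau_i is the one in omega = Omega / tau_i. The bound admits k = N, whose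
    row again involves moments below N only. *)
Lemma dOmega_Gamma i k t : (k <= N)%N ->
  dOmega i k t = Gamma_zeta (X t) (fun i => X (t - tau i))
    (fun i (l : 'I_N) => (tau i)^-1 *: Omega_at i l t) i k.
Proof.
move=> kN; apply/colP => a; rewrite !mxE summxE (deriv_slegendre (tau i) kN).
congr (_ + _); first by rewrite exprS mulN1r mulNr.
have lLX l : lbm (fun s => (slegendre (tau i) l).[s] * X (t + s) a 0).
  apply: lbmM; first exact: lbm_poly.
  exact: lbm_comp_shift (lbm_continuous (cXa (a := a))).
transitivity (- \int[mu]_(s in `[- tau i, 0])
   (\sum_(l < N) (- (gammac R k l / tau i)) *
     ((slegendre (tau i) l).[s] * X (t + s) a 0))).
  congr (- _); apply: eq_Rintegral => s _.
  rewrite hornerN horner_sum -sumrN mulr_suml; apply: eq_bigr => l _.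
  by rewrite hornerZ; ring.
rewrite Rintegral_lbm_sum => [|l]; last exact: lbmZ.
rewrite -sumrN; apply: eq_bigr => l _.
by rewrite Rintegral_lbmZ// !mxE mulNr opprK mulrA.
Qed.

(** Integration by parts in the opposite direction: the same vector is a moment of the velocity,
    which is the form Bessel's inequality needs. The bounds on t keep the window inside [- A, T]. *)
Lemma dOmega_col i k t : 0 <= t -> t <= T ->
  dOmega i k t = \col_a \int[mu]_(s in `[- tau i, 0])
    ((slegendre (tau i) k).[s] * v (t + s) a 0).
Proof.
move=> t0 tT; apply/colP => a; rewrite !mxE.
rewrite (@Rintegral_poly_lipschitz_parts R (slegendre (tau i) k) (fun t => X t a 0)
   (fun t => v t a 0) (- A) T K)//.
- by rewrite slegendre0// slegendreN// addr0 mul1r.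
- by have := tau_le i; lra.
- by rewrite addr0.
- move=> s r sA sr rT; apply: le_trans (XK sA sr rT).
  have -> : X r a 0 - X s a 0 = (X r - X s) a 0 by rewrite !mxE.
  exact: le_mx_coord.
- move: dX; apply: filterS; first exact: (ae_filter_ringOfSetsType mu).
  by move=> s H sI; exact/is_derive_coord/H.
Qed.

Section Energy.
Variable M : 'M[R]_n.

Let r t := qform M (v t).

Let lr : lbm r. Proof. exact: lbm_qform. Qed.

Definition energy_primitive : R -> R := primitive r.

(* In this form, differentiating in [t] requires Lebesgue's theorem at [t] only,
   not at [t - tau i]: the last term is an average of a continuous function. *)
Lemma kinetic_energyE i t : 0 <= t -> t <= T ->
  \int[mu]_(theta in `[- tau i, 0])
    \int[mu]_(s in `[theta, 0]) qform M (derive1 (segment X t) s) =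
  tau i * energy_primitive t
  - \int[mu]_(s in `[- tau i, 0]) energy_primitive (t + s).
Proof.
move=> t0 tT.
have lB := lbm_continuous (continuous_primitive lr).
transitivity (\int[mu]_(s in `[- tau i, 0])
    (energy_primitive t - energy_primitive (t + s))).
  apply: eq_Rintegral => theta /set_mem /=; rewrite in_itv/= => /andP[th th0].
  transitivity (\int[mu]_(s in `[theta, 0]) r (t + s)).
    apply: eq_ae_Rintegral.
    have H1 := ae_shift t dX.
    (* Without these two points, t + s lies in the open interval of [dX] even for t = 0 or t = T. *)
    have H2 := ae_neq (0 : R); have H3 := ae_neq (- A).
    have H23 : {ae mu, forall s, s != 0 /\ s != - A}.
      move: H2 H3; apply: filterS2; first exact: (ae_filter_ringOfSetsType mu).
      by move=> s ? ?; split.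
    move: H1 H23.
    apply: filterS2; first exact: (ae_filter_ringOfSetsType mu).
    move=> s dXs [s0 sA] /=; rewrite in_itv/= => /andP[ths s0'].
    have sI : t + s \in `]- A, T[.
      have sA' : - A < s.
        rewrite lt_neqAle eq_sym sA/=; have := tau_le i; lra.
      have s0'' : s < 0 by rewrite lt_neqAle s0.
      rewrite in_itv/=; apply/andP; split; lra.
    suff -> : derive1 (segment X t) s = v (t + s) by [].
    have : is_derive s 1 (segment X t) (v (t + s)).
      have -> : segment X t = (fun s => X (s + t)).
        by apply/funext => z; rewrite /segment addrC.
      by rewrite [t + s]addrC; apply: is_derive_comp_shift; rewrite addrC; exact: dXs.
    by move=> [_ <-]; rewrite derive1E.
  by rewrite Rintegral_comp_shift// -primitiveB ?addr0// gerDl.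
rewrite RintegralB//; last 2 first.
- exact: lbm_integrable (lbm_cst _).
- exact: lbm_integrable (lbm_comp_shift _ lB).
congr (_ - _); rewrite Rintegral_cst// [X in fine X]lebesgue_measure_itv/= lte_fin.
by rewrite oppr_lt0 tau_gt0 -EFinB/= sub0r opprK mulrC.
Qed.

Lemma energy_bessel i t L : psd M -> 0 <= t -> t <= T ->
  \sum_(k < L) (2 * k + 1)%:R * qform M (dOmega i k t) <=
  tau i * (energy_primitive t - energy_primitive (t - tau i)).
Proof.
move=> Mpsd t0 tT.
have lvt a : lbm (fun s => v (t + s) a 0).
  exact: (@lbm_comp_shift R (fun s => v s a 0) t (lv a)).
have -> : energy_primitive t - energy_primitive (t - tau i) =
    \int[mu]_(s in `[- tau i, 0]) qform M (v (t + s)).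
  rewrite (Rintegral_comp_shift _ _ t lr) addr0 primitiveB//.
  by rewrite lerBlDr lerDl ltW.
under eq_bigr do rewrite (dOmega_col i _ t0 tT).
exact: (bessel_legendre (tau_gt0 i) Mpsd lvt).
Qed.

End Energy.

Lemma is_derive_conv (y : R -> R) i (t : R) : continuous y ->
  is_derive t 1 (fun t => \int[mu]_(s in `[- tau i, 0]) y (t + s))
    (y t - y (t - tau i)).
Proof.
move=> cy; have H := is_derive_poly_conv 1 t (tauN_le0 i) cy.
have E (z : R -> R) : \int[mu]_(s in `[- tau i, 0]) ((1 : {poly R}).[s] * z s) =
    \int[mu]_(s in `[- tau i, 0]) z s.
  by apply: eq_Rintegral => s _; rewrite hornerC mul1r.
under eq_fun do rewrite -E.
apply: (is_derive_eq H).
rewrite !hornerC !mul1r addr0 derivC.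
under eq_Rintegral do rewrite horner0 mul0r.
by rewrite Rintegral_cst// mul0r subr0.
Qed.

Section Lyapunov.
Variables (S1 : 'cV[R]_n -> R) (P : 'M[R]_(\sum_(i < q) \sum_(k < N) n)).
Variables (Theta : 'I_q -> 'cV[R]_n -> R) (Rm : 'I_q -> 'M[R]_n).
Hypotheses (S1_C1 : C1_fun S1) (P_psd : psd P).
Hypotheses (cTheta : forall i, continuous (Theta i)).

Definition xhat_at t : 'cV[R]_(\sum_(i < q) \sum_(k < N) n) :=
  \mxcol_(i < q) \mxcol_(k < N) Omega_at i k t.

Definition dxhat t : 'cV[R]_(\sum_(i < q) \sum_(k < N) n) :=
  \mxcol_(i < q) \mxcol_(k < N) dOmega i k t.

Local Notation B i := (energy_primitive (Rm i)).

Definition lyapunov t : R :=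
  S1 (X t) + qform P (xhat_at t)
  + \sum_i \int[mu]_(s in `[- tau i, 0]) Theta i (X (t + s))
  + \sum_i tau i * (tau i * B i t - \int[mu]_(s in `[- tau i, 0]) B i (t + s)).

Definition dlyapunov t : R :=
  ((gradient S1 (X t))^T *m v t) 0 0
  + 2 * ((xhat_at t)^T *m P *m dxhat t) 0 0
  + \sum_i (Theta i (X t) - Theta i (X (t - tau i)))
  + \sum_i tau i * (tau i * qform (Rm i) (v t) - (B i t - B i (t - tau i))).

Lemma storage_form_segment t : 0 <= t -> t <= T ->
  storage_form tau S1 P Theta Rm (segment X t) = lyapunov t.
Proof.
move=> t0 tT.
have E1 : xhat N tau (segment X t) = xhat_at t.
  by apply: eq_mxcol => i; apply: eq_mxcol => k; rewrite Omega_segment.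
have E3 : \sum_(i < q) tau i * (\int[mu]_(theta in `[- tau i, 0])
      \int[mu]_(s in `[theta, 0]) qform (Rm i) (derive1 (segment X t) s)) =
    \sum_i tau i * (tau i * B i t - \int[mu]_(s in `[- tau i, 0]) B i (t + s)).
  apply: eq_bigr => i _.
  exact: (congr1 ( *%R (tau i)) (kinetic_energyE (Rm i) i t0 tT)).
rewrite /storage_form /lyapunov E1 {1}/segment addr0.
exact: (congr2 +%R (erefl _) E3).
Qed.

Let cBi i : continuous (B i).
Proof. exact: continuous_primitive (lbm_qform _ lv). Qed.

Let cThetaX i : continuous (fun t => Theta i (X t)).
Proof. by move=> t; apply: continuous_comp; [exact: cX|exact: cTheta]. Qed.

Let shiftN (y : R -> R) (c : R) : continuous y -> continuous (fun t => y (t - c)).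
Proof.
move=> cy; have := @continuous_comp_shift R _ y (- c) cy.
by under [X in continuous X -> _]eq_fun do rewrite addrC.
Qed.

Let is_derive_xhat a (t : R) :
  is_derive t 1 (fun t => xhat_at t a 0) (dxhat t a 0).
Proof.
have -> : (fun t => xhat_at t a 0) =
    (fun t => Omega_at (tagnat.sig1 a) (tagnat.sig1 (tagnat.sig2 a)) t
      (tagnat.sig2 (tagnat.sig2 a)) 0).
  by apply/funext => s; rewrite /xhat_at !mxE.
have -> : dxhat t a 0 =
    dOmega (tagnat.sig1 a) (tagnat.sig1 (tagnat.sig2 a)) t
      (tagnat.sig2 (tagnat.sig2 a)) 0 by rewrite /dxhat !mxE.
exact: is_derive_Omega.
Qed.

Let c_xhat a : continuous (fun t => xhat_at t a 0).
Proof. by move=> t; exact: derive_continuous (is_derive_xhat a t). Qed.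

Let c_dxhat a : continuous (fun t => dxhat t a 0).
Proof.
under eq_fun do rewrite /dxhat !mxE.
move=> t; apply: cvgB; first apply: cvgB.
- exact: cXa.
- by apply: cvgM; [exact: cvg_cst|exact: (shiftN (y := fun t => X t _ 0))].
- have H := is_derive_poly_conv
    (slegendre (tau (tagnat.sig1 a)) (tagnat.sig1 (tagnat.sig2 a)))^`() t
    (tauN_le0 (tagnat.sig1 a)) (cXa (a := tagnat.sig2 (tagnat.sig2 a))).
  exact: derive_continuous H.
Qed.

Let lbm_quad : lbm (fun t => 2 * ((xhat_at t)^T *m P *m dxhat t) 0 0).
Proof.
apply: lbmZ; under eq_fun do rewrite mxE.
apply: lbm_sum => b; apply: lbmM; last exact: lbm_continuous.
under eq_fun do rewrite mxE; apply: lbm_sum => a.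
apply: lbmM; last exact: lbm_cst.
by under eq_fun do rewrite mxE; exact: lbm_continuous.
Qed.

Lemma lbm_dlyapunov : lbm dlyapunov.
Proof.
apply: lbmD; first apply: lbmD; first apply: lbmD.
- under eq_fun do rewrite mxE; apply: lbm_sum => a; apply: lbmM => //.
  under eq_fun do rewrite mxE; apply: lbm_continuous.
  apply: (@continuous_coord R _ _ _ (gradient S1 \o X)) => t.
  by apply: continuous_comp; [exact: cX|exact: S1_C1.2].
- exact: lbm_quad.
- apply: lbm_sum => i; apply: lbmB; first exact: lbm_continuous.
  by apply: lbm_continuous; exact: (shiftN (y := fun t => Theta i (X t))).
- apply: lbm_sum => i; apply: lbmZ; apply: lbmB.
    by apply: lbmZ; exact: lbm_qform.
  by apply: lbmB; apply: lbm_continuous => //; exact: shiftN.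
Qed.

(** Only [S1 \o X] and the primitives [B i] may fail to be differentiable somewhere, and both are
    Lipschitz; the remaining terms have a locally bounded derivative at every time. *)
Lemma lipschitz_lyapunov : 0 <= A -> lipschitz_itv 0 T lyapunov.
Proof.
move=> A0.
apply: lipschitz_itvD; first apply: lipschitz_itvD; first apply: lipschitz_itvD.
- apply: (@lipschitz_itv_C1_comp _ _ _ _ _ _ K) => // s t s0 st tT.
  by apply: XK => //; rewrite (le_trans _ s0)// oppr_le0.
- apply: (lipschitz_itv_derive _ _ lbm_quad) => t.
  exact: is_derive_qform P_psd.1 (fun a => is_derive_xhat a t).
- apply: lipschitz_itv_sum => i.
  apply: (@lipschitz_itv_derive _ _ _ _ (fun t => Theta i (X t) - Theta i (X (t - tau i)))).
    apply: lbmB; first exact: lbm_continuous.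
    by apply: lbm_continuous; exact: (shiftN (y := fun t => Theta i (X t))).
  by move=> t; exact: (@is_derive_conv (fun t => Theta i (X t))).
- apply: lipschitz_itv_sum => i; apply: lipschitz_itvZ.
  have -> : (fun t => tau i * B i t - \int[mu]_(s in `[- tau i, 0]) B i (t + s)) =
    (fun t => tau i * B i t + (-1) * \int[mu]_(s in `[- tau i, 0]) B i (t + s)).
    by apply/funext => t; rewrite mulN1r.
  apply: lipschitz_itvD; apply: lipschitz_itvZ.
    exact: lipschitz_itv_primitive (lbm_qform _ lv).
  apply: (@lipschitz_itv_derive _ _ _ _ (fun t => B i t - B i (t - tau i))).
    by apply: lbmB; apply: lbm_continuous => //; exact: shiftN.
  by move=> t; exact: is_derive_conv.
Qed.

Lemma ae_is_derive_lyapunov : 0 <= A ->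
  {ae mu, forall t, t \in `]0, T[ -> is_derive t 1 lyapunov (dlyapunov t)}.
Proof.
move=> A0.
(* There are finitely many indices, so a single null set serves all of them. *)
have H : \forall t \ae mu, forall i, 0 < t ->
    is_derive (t : R) 1 (B i) (qform (Rm i) (v t)).
  apply: filter_forall => i.
  exact: ae_is_derive_primitive (lbm_qform _ lv).
move: dX H; apply: filterS2; first exact: (ae_filter_ringOfSetsType mu).
move=> t dXt dB; rewrite in_itv/= => /andP[t0 tT].
have {}dXt : is_derive t 1 X (v t).
  by apply: dXt; rewrite in_itv/= tT andbT (le_lt_trans _ t0)// oppr_le0.
apply: is_deriveD; first apply: is_deriveD; first apply: is_deriveD.
- exact: is_derive_chain (S1_C1.1 _) dXt.
- exact: is_derive_qform P_psd.1 (fun a => is_derive_xhat a t).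
- by apply: is_derive_bigsum => i; exact: (@is_derive_conv (fun t => Theta i (X t))).
- apply: is_derive_bigsum => i.
  apply: is_deriveZ; apply: is_deriveB; last exact: is_derive_conv.
  by apply: is_deriveZ; exact: dB.
Qed.

Lemma lyapunov_FTC t0 t1 : 0 <= A -> 0 <= t0 -> t0 <= t1 -> t1 <= T ->
  lyapunov t1 - lyapunov t0 = \int[mu]_(t in `[t0, t1]) dlyapunov t.
Proof.
move=> A0 t00 t01 t1T; have [L HL] := lipschitz_lyapunov A0.
apply: (@lipschitz_FTC _ _ _ _ _ L) => //; first exact: lbm_dlyapunov.
  move=> s t st0 st tt1; apply: HL => //; first exact: le_trans st0.
  exact: le_trans t1T.
move: (ae_is_derive_lyapunov A0).
apply: filterS; first exact: (ae_filter_ringOfSetsType mu).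
move=> t H; rewrite in_itv/= => /andP[t0t tt1]; apply: H.
by rewrite in_itv/= (le_lt_trans t00 t0t) (lt_le_trans tt1 t1T).
Qed.

Variables (m : nat) (f : 'cV[R]_(n + \sum_(i < q) n) -> 'cV[R]_n)
  (g : 'cV[R]_n -> 'M[R]_(n, m)) (h : 'cV[R]_n -> 'cV[R]_m)
  (S11 S12 S22 : 'M[R]_m).
Hypothesis Rm_psd : forall i, psd (Rm i).
Hypothesis LMI : forall x0 xd w,
  nsd (Psi_mx tau f g h S11 S12 S22 S1 P Theta Rm x0 xd (w : 'I_q -> 'I_N -> 'cV_n)).

(** The matrix inequality is used at omega = Omega / tau_i, for which tau_i omega and [Gamma_zeta]
    stack to [xhat_at] and [dxhat]. Bessel's inequality is taken with N + 1 moments of the velocity,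
    one more than [xhat_at] holds moments of the state for each delay. *)
Lemma dlyapunov_le t (u : 'cV[R]_m) : 0 <= t -> t <= T ->
  v t = f (col_mx (X t) (\mxcol_(i < q) X (t - tau i))) + g (X t) *m u ->
  dlyapunov t <= quadratic_supply S11 S12 S22 (h (X t)) u.
Proof.
move=> t0 tT vE.
pose w i (l : 'I_N) := (tau i)^-1 *: Omega_at i l t.
have := dissipation_ineq u P_psd Rm_psd
  (LMI (X t) (fun i => X (t - tau i)) w).
rewrite /= -vE; apply: le_trans; rewrite /dlyapunov.
have -> : \mxcol_(i < q) \mxcol_(k < N) (tau i *: w i k) = xhat_at t.
  apply: eq_mxcol => i; apply: eq_mxcol => k.
  by rewrite /w scalerA mulfV ?gt_eqF// scale1r.
have -> : \mxcol_(i < q) \mxcol_(k < N) Gamma_zeta (X t) (fun i => X (t - tau i)) w i k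
    = dxhat t.
  apply: eq_mxcol => i; apply: eq_mxcol => k.
  by rewrite -dOmega_Gamma// ltnW.
rewrite lerD2l; apply: ler_sum => i _.
rewrite mulrBr mulrA -expr2 lerD2l lerN2.
have := energy_bessel i N.+1 (Rm_psd i) t0 tT; apply: le_trans.
rewrite le_eqVlt; apply/orP; left; apply/eqP; apply: eq_bigr => k _.
by rewrite -dOmega_Gamma// -ltnS.
Qed.

End Lyapunov.
End StorageAlongSolution.

(** * Extending a solution to the whole line *)

Section Clamp.
Variable R : realType.
Implicit Types (a b s t : R).

Definition clamp a b t : R := Num.max a (Num.min b t).

Lemma clamp_itv a b t : a <= b -> clamp a b t \in `[a, b].
Proof.
by move=> ab; rewrite in_itv/= /clamp le_max lexx/= ge_max ab ge_min lexx.
Qed.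

Lemma clamp_id a b t : t \in `[a, b] -> clamp a b t = t.
Proof.
by rewrite in_itv/= => /andP[at_ tb]; rewrite /clamp min_r// max_r.
Qed.

Lemma clamp_continuous a b : continuous (clamp a b).
Proof.
apply: lipschitz_itv_continuous => c d; exists 1 => s t _ st _.
rewrite mul1r /clamp ler_norml; apply/andP; split.
  rewrite (@le_trans _ _ 0)// ?oppr_le0 ?subr_ge0//.
  by rewrite ge_max !le_max lexx/= le_min !ge_min lexx st/= !orbT.
set M := Num.max a (Num.min b s).
have aM : a <= M by rewrite /M le_max lexx.
have bsM : Num.min b s <= M by rewrite /M le_max lexx orbT.
have bts : Num.min b t <= Num.min b s + (t - s).
  have tbt : Num.min b t <= t by rewrite ge_min lexx orbT.
  have bbt : Num.min b t <= b by rewrite ge_min lexx.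
  by case: (lerP b s) => bs; lra.
by rewrite lerBlDr ge_max; apply/andP; split; lra.
Qed.

(** Turns continuity within a closed interval, one-sided at its ends, into continuity on the
    line. *)
Lemma continuous_comp_clamp (V : topologicalType) (y : R -> V) a b : a <= b ->
  {within `[a, b], continuous y} -> continuous (y \o clamp a b).
Proof.
move=> ab /subspace_continuousP yc t U /= HU.
have := yc _ (clamp_itv t ab) U HU => /= HU'.
have H : \forall s \near t,
    `[a, b]%classic (clamp a b s) -> U (y (clamp a b s)).
  exact: (@clamp_continuous a b t _ HU').
change (\forall s \near t, U (y (clamp a b s))).
by near=> s; apply: (near H s) => //; exact: clamp_itv.
Unshelve. all: by end_near. Qed.

End Clamp.

Section C1on.
Variables (R : realType) (n : nat) (a b : R) (phi dphi : R -> 'cV[R]_n).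
Hypothesis dphi_lim : forall s, s \in `[a, b] ->
  (t - s)^-1 *: (phi t - phi s) @[t --> within `[a, b] s^'] --> dphi s.

Lemma C1_on_near s e : s \in `[a, b] -> 0 < e ->
  \forall t \near s, t \in `[a, b] ->
    `|phi t - phi s| <= (`|dphi s| + e) * `|t - s|.
Proof.
move=> sab e0; have /cvgrPdist_lt /(_ _ e0) := dphi_lim sab.
rewrite near_withinE /= => H.
move: H; rewrite /dnbhs near_withinE; apply: filterS => t H tab.
have [->|ts] := eqVneq t s; first by rewrite !subrr !normr0 mulr0.
have {H} := H ts tab; set d := dphi s; set z := _ *: _ => dz.
have -> : phi t - phi s = (t - s) *: z.
  by rewrite /z scalerA mulfV ?subr_eq0// scale1r.
rewrite normrZ mulrC ler_wpM2r// -[z](subKr d).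
by apply: le_trans (ler_normB _ _) _; rewrite lerD2l ltW.
Qed.

Lemma C1_on_is_derive s : s \in `]a, b[ -> is_derive s 1 phi (dphi s).
Proof.
move=> sab.
have sab' : s \in `[a, b] by exact: subset_itv_oo_cc.
suff H : h^-1 *: (phi (h + s) - phi s) @[h --> 0^'] --> dphi s.
  have E : (fun h : R => h^-1 *: ((phi \o shift s) (h *: 1) - phi s)) =
      (fun h => h^-1 *: (phi (h + s) - phi s)).
    by apply/funext => h /=; rewrite [h *: 1]mulr1.
  apply: DeriveDef; first by rewrite /derivable E; apply: cvgP H.
  by rewrite /derive E; exact: cvg_lim.
apply/cvgrPdist_lt => e e0.
have /cvgrPdist_lt /(_ _ e0) := dphi_lim sab'.
rewrite near_withinE /= /dnbhs near_withinE => H.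
rewrite near_withinE.
move: (near_in_itvoo sab) H => /nbhs0P H1 /nbhs0P H2.
move: H1 H2; apply: filterS2 => h shab H h0.
have := H _ (subset_itv_oo_cc shab).
rewrite [s + h]addrC addrK; apply.
by rewrite -subr_eq0 addrK.
Qed.

Lemma C1_on_lipschitz : a <= b -> {within `[a, b], continuous dphi} ->
  exists2 K, 0 <= K & forall s t, a <= s -> s <= t -> t <= b ->
    `|phi t - phi s| <= K * (t - s).
Proof.
move=> ab cdphi.
have cd := continuous_comp_clamp ab cdphi.
have [|K HK] := (lbm_continuous (w := fun t => `|(dphi \o clamp a b) t|) _).2 a b.
  by move=> t; apply: continuous_comp; [exact: cd|exact: norm_continuous].
exists (`|K| + 1); first by rewrite addr_ge0.
apply: local_lipschitz_on => c ac cb.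
have cab : c \in `[a, b] by rewrite in_itv/= ac.
have /nbhs_ballP[e /= e0 He] := C1_on_near cab ltr01.
exists e => // t at_ tb tce; apply: le_trans (He t _ _) _.
- by rewrite /ball/= distrC.
- by rewrite in_itv/= at_.
rewrite ler_wpM2r// lerD2r; apply: le_trans (ler_norm K).
by have := HK c ac cb; rewrite /= clamp_id// normr_id.
Qed.

End C1on.

Lemma abs_continuous_within (R : realType) n (a b : R) (x : R -> 'cV[R]_n) :
  abs_continuous_on a b x -> {within `[a, b], continuous x}.
Proof.
move=> ac; apply/subspace_continuousP => c /=; rewrite in_itv/= => /andP[ac_ cb].
apply/cvgrPdist_lt => e e0; have [d d0 Hd] := ac e e0.
rewrite near_withinE; near=> t => /=; rewrite in_itv/= => /andP[at_ tb].
have tcd : `|c - t| < d.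
  by near: t; have /cvgrPdist_lt := @cvg_id _ (nbhs c); apply.
have H s r : a <= s -> s <= r -> r <= b -> r - s < d -> `|x r - x s| < e.
  move=> as_ sr rb srd.
  (* A family made of one interval suffices. *)
  have := Hd 1 (fun=> s) (fun=> r); rewrite !big_ord1; apply => //.
  by move=> i j; rewrite !ord1.
move: tcd; rewrite ltr_norml => /andP[t1 t2].
have [ct|tc] := leP c t; last by apply: H => //; lra.
by rewrite distrC; apply: H => //; lra.
Unshelve. all: by end_near. Qed.

Lemma continuous_col_mx (R : realType) (T : topologicalType) m1 m2 n
    (y1 : T -> 'M[R]_(m1, n)) (y2 : T -> 'M[R]_(m2, n)) :
  continuous y1 -> continuous y2 -> continuous (fun t => col_mx (y1 t) (y2 t)).
Proof.
move=> c1 c2; apply: mx_continuousP => i j.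
under eq_fun do rewrite mxE.
by case: (fintype.split i) => k; exact: continuous_coord.
Qed.

Lemma continuous_mxcol (R : realType) (T : topologicalType) q (p : 'I_q -> nat) n
    (y : forall i, T -> 'M[R]_(p i, n)) :
  (forall i, continuous (y i)) -> continuous (fun t => \mxcol_i y i t).
Proof.
move=> cy; apply: mx_continuousP => i j.
by under eq_fun do rewrite mxE; exact: continuous_coord.
Qed.

(** * Regularity of the solution frozen outside its interval *)

Section Reduction.
Variables (R : realType) (n m q : nat) (tau : 'I_q.+1 -> R) (A T : R).
Hypotheses (tau_gt0 : forall i, 0 < tau i) (tau_le : forall i, tau i <= A).
Hypotheses (A_ge0 : 0 <= A) (T_ge0 : 0 <= T).
Variables (f : 'cV[R]_(n + \sum_(i < q.+1) n) -> 'cV[R]_n)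
  (g : 'cV[R]_n -> 'M[R]_(n, m)).
Hypotheses (cf : continuous f) (cg : continuous g).
Variables (phi dphi x : R -> 'cV[R]_n) (u : R -> 'cV[R]_m).
Local Notation mu := (@lebesgue_measure R).
Local Notation lbm := (@locally_bounded_measurable R).
Hypothesis cdphi : {within `[- A, 0], continuous dphi}.
Hypothesis dphi_lim : forall s, s \in `[- A, 0] ->
  (t - s)^-1 *: (phi t - phi s) @[t --> within `[- A, 0] s^'] --> dphi s.
Hypothesis uT : admissible_input T u.
Hypothesis x_phi : forall t, t \in `[- A, 0] -> x t = phi t.
Hypothesis x_ac : abs_continuous_on 0 T x.

Definition clamped : R -> 'cV[R]_n := x \o clamp (- A) T.

Let AN_le0 : - A <= 0. Proof. by rewrite oppr_le0. Qed.

Let AT : - A <= T. Proof. exact: le_trans T_ge0. Qed.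

Let clampedE t : - A <= t -> t <= T -> clamped t = x t.
Proof. by move=> At tT; rewrite /clamped /= clamp_id// in_itv/= At. Qed.

Let x_lipschitz_left : exists2 K, 0 <= K &
  forall s t, - A <= s -> s <= t -> t <= 0 -> `|x t - x s| <= K * (t - s).
Proof.
have [K K0 HK] := C1_on_lipschitz dphi_lim AN_le0 cdphi.
exists K => // s t As st t0; rewrite !x_phi ?HK//.
  by rewrite in_itv/= As (le_trans st).
by rewrite in_itv/= t0 (le_trans As).
Qed.

(** Two closed pieces are glued at 0. On [0, T] only absolute continuity is available yet: the
    Lipschitz bound there comes from a bound on [velocity], which itself rests on this
    continuity. *)
Lemma clamped_continuous : continuous clamped.
Proof.
apply: continuous_comp_clamp => //.
have -> : `[- A, T]%classic = `[- A, 0]%classic `|` `[0, T]%classic.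
  apply/seteqP; split => t /=; rewrite !in_itv/=.
    by move=> /andP[-> ->]; rewrite andbT; case: (leP t 0) => t0 /=; [left|right; exact: ltW].
  by move=> [/andP[-> t0]|/andP[t0 ->]]; rewrite ?andbT ?(le_trans _ t0)// (le_trans t0).
apply: withinU_continuous; [exact: interval_closed|exact: interval_closed| |].
  have [K K0 HK] := x_lipschitz_left.
  apply/subspace_continuousP => c /=; rewrite in_itv/= => /andP[Ac c0].
  apply/cvgrPdist_lt => e e0; rewrite near_withinE; near=> t => /=.
  rewrite in_itv/= => /andP[At t0].
  have tce : `|c - t| < e / (K + 1).
    near: t; have /cvgrPdist_lt := @cvg_id _ (nbhs c); apply.
    by rewrite divr_gt0// ltr_wpDl.
  move: tce; rewrite ltr_pdivlMr ?ltr_wpDl// => tce.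
  have [ct|tc] := leP c t.
    rewrite distrC (le_lt_trans (HK _ _ Ac ct t0))//.
    move: tce; rewrite distrC ger0_norm ?subr_ge0//; nra.
  rewrite (le_lt_trans (HK _ _ At (ltW tc) c0))//.
  by move: tce; rewrite ger0_norm ?subr_ge0 ?ltW//; nra.
exact: abs_continuous_within.
Unshelve. all: by end_near. Qed.

Definition clamped_dynamics t : 'cV[R]_n :=
  f (col_mx (clamped t) (\mxcol_(i < q.+1) clamped (t - tau i)))
  + g (clamped t) *m (if t \in `[0, T] then u t else 0).

(* The values outside [- A, T] are irrelevant but keep the components locally
   bounded and measurable on the whole line. *)
Definition velocity t : 'cV[R]_n :=
  if 0 <= t then clamped_dynamics t else dphi (clamp (- A) 0 t).

Let lbm_input b : lbm (fun t => (if t \in `[0, T] then u t else 0) b 0).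
Proof.
have [mu_ [M HM]] := uT; split.
  have := (measurable_restrictT (fun t => u t b 0) (measurable_itv `[0, T])).1 (mu_ b).
  have -> : (fun t => u t b 0) \_ `[0, T] =
      (fun t => (if t \in `[0, T] then u t else 0) b 0).
    apply/funext => t; rewrite patchE mem_setE; case: ifP => //.
    by rewrite mxE.
  by apply.
move=> a c; exists `|M| => t _ _; case: ifPn => tI; last by rewrite mxE normr0.
by apply: le_trans (le_mx_coord _ _ _) _; apply: le_trans (HM t tI) (ler_norm _).
Qed.

Lemma lbm_velocity a : lbm (fun t => velocity t a 0).
Proof.
have cX := clamped_continuous.
have cXi i : continuous (fun t => clamped (t - tau i)).
  have := @continuous_comp_shift R _ clamped (- tau i) cX.
  by under [X in continuous X -> _]eq_fun do rewrite addrC.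
have lI : lbm (fun t => (0 <= t)%R%:R).
  split; last first.
    by move=> b c; exists 1 => t _ _; case: (0 <= t); rewrite ?normr1 ?normr0 ?ler01.
  have -> : (fun t : R => (0 <= t)%R%:R) = \1_(`[0, +oo[) :> (R -> R).
    by apply/funext => t; rewrite indicE mem_setE in_itv/= andbT.
  exact: measurable_indic.
(* The case distinction becomes a sum weighted by an indicator, so that closure under sums and
   products applies. *)
have -> : (fun t => velocity t a 0) = (fun t =>
    (0 <= t)%R%:R * clamped_dynamics t a 0
    + (1 - (0 <= t)%R%:R) * (dphi \o clamp (- A) 0) t a 0).
  apply/funext => t; rewrite /velocity; case: ifPn => _ /=.
    by rewrite mul1r subrr mul0r addr0.
  by rewrite mul0r subr0 mul1r add0r.
apply: lbmD; apply: lbmM => //; last 2 first.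
- exact: lbmB (lbm_cst _) lI.
- by apply/lbm_continuous/continuous_coord; exact: continuous_comp_clamp.
under eq_fun do rewrite /clamped_dynamics mxE.
apply: lbmD.
  apply/lbm_continuous/continuous_coord => t.
  apply: (@continuous_comp _ _ _
    (fun t => col_mx (clamped t) (\mxcol_(i < q.+1) clamped (t - tau i))) f).
    apply: continuous_col_mx => //.
    exact: (@continuous_mxcol _ _ _ _ _ (fun i t => clamped (t - tau i))).
  exact: cf.
under eq_fun do rewrite mxE.
apply: lbm_sum => b; apply: lbmM => //.
apply/lbm_continuous/continuous_coord => t.
by apply: (@continuous_comp _ _ _ clamped g); [exact: cX|exact: cg].
Qed.

Hypothesis dx : {ae mu, forall t, t \in `]0, T[ ->
  is_derive t (1 : R) x (dynamics tau f g x u t)}.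

Let velocity_dynamics t : 0 <= t -> t <= T ->
  velocity t = dynamics tau f g x u t.
Proof.
move=> t0 tT; rewrite /velocity t0 /clamped_dynamics in_itv/= t0 tT/=.
have -> : clamped t = x t by rewrite clampedE// (le_trans _ t0).
rewrite /dynamics; congr (f (col_mx _ _) + _); apply: eq_mxcol => i.
rewrite clampedE//; first by have := tau_le i; lra.
by have := tau_gt0 i; lra.
Qed.

Let velocity_le : exists2 M, 0 <= M &
  forall t, 0 <= t -> t <= T -> `|velocity t| <= M.
Proof.
have lw : lbm (fun t => \sum_a velocity t a 0 ^+ 2).
  apply: lbm_sum => a; exact: lbmM (lbm_velocity a) (lbm_velocity a).
have [M HM] := lw.2 0 T.
(* Each squared component is at most |M|, and z <= z^2 + 1. *)
exists (`|M| + 1); first by rewrite addr_ge0.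
move=> t t0 tT; apply: mx_norm_le_bound => [|i j]; first by rewrite addr_ge0.
rewrite ord1; have := HM t t0 tT; rewrite ger0_norm; last first.
  by apply: sumr_ge0 => b _; exact: sqr_ge0.
rewrite (bigD1 i)//=.
have S0 : 0 <= \sum_(b < n | b != i) velocity t b 0 ^+ 2.
  by apply: sumr_ge0 => b _; exact: sqr_ge0.
have := ler_norm M; move: S0; set S := \sum_(b < n | _) _.
by rewrite -(real_normK (num_real (velocity t i 0))); nra.
Qed.

(** The bounded velocity upgrades absolute continuity to a Lipschitz bound, the regularity assumed
    in the study of the storage. *)
Let x_lipschitz_right : exists2 K, 0 <= K &
  forall s t, 0 <= s -> s <= t -> t <= T -> `|x t - x s| <= K * (t - s).
Proof.
have [M M0 HM] := velocity_le; exists M => // s t s0 st tT.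
apply: absolutely_continuous_le => //.
  move=> e e0; have [d d0 Hd] := x_ac e0; exists d => // p l r lr; apply: Hd.
  move=> i; have [sl lri rt] := lr i; split => //.
    exact: le_trans sl.
  exact: le_trans tT.
move: dx; apply: filterS; first exact: (ae_filter_ringOfSetsType mu).
move=> r dxr; rewrite in_itv/= => /andP[sr rt].
have r0 : 0 < r by apply: le_lt_trans sr.
have rT : r < T by apply: lt_le_trans tT.
exists (velocity r); last by rewrite HM// ltW.
by rewrite velocity_dynamics ?ltW//; apply: dxr; rewrite in_itv/= r0.
Qed.

Lemma clamped_lipschitz : exists K, forall s t, - A <= s -> s <= t -> t <= T ->
  `|clamped t - clamped s| <= K * (t - s).
Proof.
have [K K0 HK] := x_lipschitz_left; have [L L0 HL] := x_lipschitz_right.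
exists (K + L) => s t As st tT.
rewrite !clampedE ?(le_trans st tT) ?(le_trans As st)//.
have [t0|t0] := leP t 0.
  by apply: le_trans (HK _ _ As st t0) _; rewrite ler_wpM2r ?subr_ge0// lerDl.
have [s0|s0] := leP 0 s.
  by apply: le_trans (HL _ _ s0 st tT) _; rewrite ler_wpM2r ?subr_ge0// lerDr.
rewrite -(subrKA (x 0)); apply: le_trans (ler_normD _ _) _.
have := HK s 0 As (ltW s0) (lexx _); have := HL 0 t (lexx _) (ltW t0) tT.
rewrite subr0 sub0r; nra.
Qed.

(** Time 0, where the derivative may jump, is discarded. Before it the curve coincides locally with
    the history, after it with the solution. *)
Lemma ae_is_derive_clamped :
  {ae mu, forall t, t \in `]- A, T[ -> is_derive t 1 clamped (velocity t)}.
Proof.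
move: dx (ae_neq (0 : R)).
apply: filterS2; first exact: (ae_filter_ringOfSetsType mu).
move=> t dxt tn0 tI.
have near_clamped : \forall s \near t, x s = clamped s.
  apply: filterS (near_in_itvoo tI) => s; rewrite in_itv/= => /andP[As sT].
  by rewrite clampedE// ltW.
apply: (near_eq_is_derive near_clamped).
move: tI; rewrite in_itv/= => /andP[At tT].
have [t0|t0] := ltP 0 t.
  by rewrite velocity_dynamics ?ltW//; apply: dxt; rewrite in_itv/= t0.
have {tn0}t0 : t < 0 by rewrite lt_neqAle tn0.
have tI : t \in `]- A, 0[ by rewrite in_itv/= At.
have near_phi : \forall s \near t, phi s = x s.
  apply: filterS (near_in_itvoo tI) => s; rewrite in_itv/= => /andP[As s0].
  by rewrite x_phi// in_itv/= !ltW.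
apply: (near_eq_is_derive near_phi).
rewrite /velocity leNgt t0/= clamp_id; first exact: (C1_on_is_derive dphi_lim).
exact: subset_itv_oo_cc.
Qed.

End Reduction.

Theorem theorem1 (R : realType) (n m q N : nat)
  (tau : 'I_q.+1 -> R)
  (htau_pos : 0 < tau ord0)
  (htau_mono : forall i j : 'I_q.+1, (i <= j)%N -> tau i <= tau j)
  (f : 'cV[R]_(n + \sum_(i < q.+1) n) -> 'cV[R]_n)
  (g : 'cV[R]_n -> 'M[R]_(n, m))
  (h : 'cV[R]_n -> 'cV[R]_m)
  (hf : locally_lipschitz f)
  (hg : locally_lipschitz g)
  (S11 S12 S22 : 'M[R]_m)
  (hS11 : S11 = S11^T)
  (hS22 : S22 = S22^T)
  (S1 : 'cV[R]_n -> R)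
  (P : 'M[R]_(\sum_(i < q.+1) \sum_(k < N) n))
  (Theta : 'I_q.+1 -> 'cV[R]_n -> R)
  (Rm : 'I_q.+1 -> 'M[R]_n)
  (hS1_C1 : C1_fun S1)
  (hS1_ge0 : forall x, 0 <= S1 x)
  (hP : psd P)
  (hTheta_cont : forall i, continuous (Theta i))
  (hTheta_psd : forall i, psd_fun (Theta i))
  (hRm : forall i, psd (Rm i))
  (hSN0 : storage_form tau S1 P Theta Rm (fun=> 0) = 0)
  (hLMI : forall (x0 : 'cV[R]_n) (xd : 'I_q.+1 -> 'cV[R]_n)
            (w : 'I_q.+1 -> 'I_N -> 'cV[R]_n),
     nsd (Psi_mx tau f g h S11 S12 S22 S1 P Theta Rm x0 xd w)) :
  dissipative tau f g h (quadratic_supply S11 S12 S22).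
Proof.
set A := tau ord_max.
have tau_gt0 i : 0 < tau i by apply: lt_le_trans htau_pos (htau_mono _ _ _).
have tau_le i : tau i <= A by apply: htau_mono; rewrite -ltnS ltn_ord.
have A_ge0 : 0 <= A by apply: ltW; exact: tau_gt0.
have cf : continuous f by exact: locally_lipschitz_continuous.
have cg : continuous g by exact: locally_lipschitz_continuous.
have stE phi psi := @storage_form_eq R n q.+1 N tau A tau_le S1 P Theta Rm phi psi A_ge0.
exists (storage_form tau S1 P Theta Rm); split => //.
  move=> phi; rewrite /storage_form !addr_ge0//.
  - exact: hP.2.
  - apply: sumr_ge0 => i _; apply: Rintegral_ge0 => s _.
    exact: (hTheta_psd i).2.
  - apply: sumr_ge0 => i _; apply: mulr_ge0; first exact: ltW.
    apply: Rintegral_ge0 => theta _; apply: Rintegral_ge0 => s _.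
    exact: (hRm i).2.
move=> T phi u x [dphi [cdphi dphi_lim]] uT [x_phi x_ac dx] t0 t1 t00 t01 t1T.
have T_ge0 : 0 <= T by apply: le_trans t1T; exact: le_trans t01.
set X := clamped A T x.
set v := velocity tau A T f g dphi x u.
have cX : continuous X := clamped_continuous A_ge0 T_ge0 cdphi dphi_lim x_phi x_ac.
have lv := lbm_velocity tau A_ge0 T_ge0 cf cg cdphi dphi_lim uT x_phi x_ac.
have [K XK] := clamped_lipschitz tau_gt0 tau_le A_ge0 T_ge0 cf cg cdphi dphi_lim
  uT x_phi x_ac dx.
have dX := ae_is_derive_clamped tau_gt0 tau_le A_ge0 dphi_lim x_phi dx.
have XE t : - A <= t -> t <= T -> X t = x t.
  by move=> At tT; rewrite /X /clamped /= clamp_id// in_itv/= At.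
have SE t : 0 <= t -> t <= T -> storage_form tau S1 P Theta Rm (segment x t) =
    lyapunov tau X v S1 P Theta Rm t.
  move=> t_ge0 tT; transitivity (storage_form tau S1 P Theta Rm (segment X t)).
    apply: stE => s; rewrite in_itv/= => /andP[As s0].
    by rewrite /segment XE//; lra.
  exact: (storage_form_segment tau_gt0 tau_le lv dX S1 P Theta Rm t_ge0 tT).
rewrite (SE t1 (le_trans t00 t01) t1T) (SE t0 t00 (le_trans t01 t1T)).
rewrite (lyapunov_FTC tau_gt0 cX lv XK dX Rm hS1_C1 hP hTheta_cont A_ge0 t00 t01 t1T).
have lD := lbm_dlyapunov tau_gt0 cX lv P Rm hS1_C1 hTheta_cont.
(* The derivative of the storage is locally bounded and measurable, so its integral is finite and
   the real identity passes to the extended reals. *)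
rewrite /Rintegral fineK; last first.
  by apply: integrable_fin_num => //; exact: lbm_integrable lD.
(* The comparison holds at every r, because [velocity] is given by the dynamics on all of [0, T],
   whether or not the solution is differentiable at r. *)
apply: le_ae_integral; apply: aeW => r /=; rewrite in_itv/= => /andP[t0r rt1].
have r0 : 0 <= r := le_trans t00 t0r.
have rT : r <= T := le_trans rt1 t1T.
rewrite lee_fin -(XE r) ?(le_trans _ r0) ?oppr_le0//.
apply: (dlyapunov_le tau_gt0 tau_le cX lv XK dX hP hRm hLMI r0 rT).
by rewrite /v /velocity r0 /clamped_dynamics in_itv/= r0 rT.
Qed.
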